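(* Let $X$ be a L\'evy process satisfying the Cram\'er condition $Ee^{\nu_0X_1}=1$ for some $\nu_0>0$, and assume $\mu^*:=E(X_1e^{\nu_0X_1})<\infty$ (so that $0<\mu^*<\infty$). Then, as $u\to\infty$, $$\frac{X_{\tau_u}}{u}\to1,\qquad \frac{G_{\tau_u-}}{u}\to\frac1{\mu^*},\qquad \frac{\tau_u}{u}\to\frac1{\mu^*},$$ each in probability conditionally on $\tau_u<\infty$ (i.e. in $P^{(u)}$-probability). Assume in addition that the support of $\Pi_X$ is non-lattice in the case that $X$ is compound Poisson. Then $$\lim_{u\to\infty}\frac{E^{(u)}X_{\tau_u}}{u}=1,\qquad \lim_{u\to\infty}\frac{E^{(u)}G_{\tau_u-}}{u}=\frac1{\mu^*},\qquad \lim_{u\to\infty}\frac{E^{(u)}\tau_u}{u}=\frac1{\mu^*}.$$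
   Context: $X=(X_t)_{t\ge0}$, $X_0=0$, is a real L\'evy process with L\'evy measure $\Pi_X$; standing assumptions: $\Pi_X$ is not identically zero and $X$ is not the negative of a subordinator. A compound Poisson process means a L\'evy process with finite L\'evy measure, no Brownian component and zero drift. $\overline X_t=\sup_{0\le s\le t}X_s$; $G_t=\sup\{0\le s\le t:X_s=\overline X_s\}$; $\tau_u=\inf\{t\ge0:X_t>u\}$ for $u>0$, with $\inf\emptyset=+\infty$; $G_{\tau_u-}$ is the left limit of $t\mapsto G_t$ at $\tau_u$, i.e. the time of the last maximum before passage above $u$. Under the Cram\'er condition $X_t\to-\infty$ a.s. as $t\to\infty$, $P(\tau_u<\infty)\to 0$ as $u\to\infty$, and $\mu^*\in(0,\infty]$. $P^{(u)}(\cdot)=P(\cdot\mid\tau_u<\infty)$, with expectation $E^{(u)}$; convergence $Z_u\to z$ in $P^{(u)}$-probability means $P^{(u)}(|Z_u-z|>\varepsilon)\to0$ as $u\to\infty$ for every $\varepsilon>0$. *)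

(* Defs.v *)
From HB Require Import structures.
From mathcomp Require Import all_boot all_order all_algebra.
From mathcomp Require Import all_classical all_reals all_analysis.

Set Implicit Arguments.
Unset Strict Implicit.
Unset Printing Implicit Defensive.

Import Order.TTheory GRing.Theory Num.Theory.
Import numFieldNormedType.Exports.

Local Open Scope classical_set_scope.
Local Open Scope ring_scope.

(* A process is a function X : R -> T -> R of time and outcome; only the times
   t >= 0 are meaningful. *)

Section LevyProcess.
Context {d : measure_display} {T : measurableType d} {R : realType}.
Variable P : probability T R.
Implicit Type X : R -> T -> R.

Definition cadlag (f : R -> R) : Prop :=
  (forall t : R, 0 <= t -> f s @[s --> t^'+] --> f t) /\
  (forall t : R, 0 < t -> cvg (f s @[s --> t^'-])).

(* Taking some of the B i equal to setT gives the product rule for every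
   subfamily of the increments. *)
Definition independent_increments X : Prop :=
  forall (n : nat) (t : nat -> R) (B : nat -> set (measurableTypeR R)),
    0 <= t 0%N -> (forall i, t i <= t i.+1) -> (forall i, measurable (B i)) ->
    P [set w | forall i, (i < n)%N -> B i (X (t i.+1) w - X (t i) w)] =
    (\prod_(i < n) P [set w | B i (X (t i.+1) w - X (t i) w)%R])%E.

Definition stationary_increments X : Prop :=
  forall (s t : R) (B : set (measurableTypeR R)),
    0 <= s -> 0 <= t -> measurable B ->
    P [set w | B (X (s + t) w - X s w)] = P [set w | B (X t w)].

Record levy_process X : Prop := LevyProcess {
  levy_measurable : forall t : R, 0 <= t -> measurable_fun setT (X t);
  levy_start : forall w, X 0 w = 0;
  levy_cadlag : forall w, cadlag (X ^~ w);
  levy_independent : independent_increments X;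
  levy_stationary : stationary_increments X }.

Definition subordinator X : Prop :=
  levy_process X /\
  {ae P, forall w, forall s t, 0 <= s -> s <= t -> X s w <= X t w}.

Definition levy_measure
    (Pi : {measure set (measurableTypeR R) -> \bar R}) : Prop :=
  Pi [set 0] = 0%E /\
  (\int[Pi]_x (Num.min 1 ((x : R) ^+ 2))%:E < +oo)%E.

(* The characteristic exponent is
     Psi(theta) = i theta gamma - sigma^2 theta^2 / 2
       + \int (e^{i theta x} - 1 - i theta x 1_{|x| <= 1}) Pi(dx);
   its real and imaginary parts are written separately. *)
Definition levy_exponent_Re (sigma : R)
    (Pi : {measure set (measurableTypeR R) -> \bar R}) (theta : R) : R :=
  - (sigma ^+ 2 * theta ^+ 2 / 2) + \int[Pi]_x (cos (theta * (x : R)) - 1).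

Definition levy_exponent_Im (gamma : R)
    (Pi : {measure set (measurableTypeR R) -> \bar R}) (theta : R) : R :=
  theta * gamma +
  \int[Pi]_x (sin (theta * (x : R)) -
              (if `|x : R| <= 1 then theta * (x : R) else 0)).

(* E e^{i theta X_t} = e^{t Psi(theta)}, split into real and imaginary parts. *)
Definition levy_triplet X (gamma sigma : R)
    (Pi : {measure set (measurableTypeR R) -> \bar R}) : Prop :=
  levy_measure Pi /\
  forall t theta : R, 0 <= t ->
    ('E_P[fun w => cos (theta * X t w)] =
       (expR (t * levy_exponent_Re sigma Pi theta) *
        cos (t * levy_exponent_Im gamma Pi theta))%:E)%E /\
    ('E_P[fun w => sin (theta * X t w)] =
       (expR (t * levy_exponent_Re sigma Pi theta) *
        sin (t * levy_exponent_Im gamma Pi theta))%:E)%E.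

Definition cramer_condition X (nu0 : R) : Prop :=
  ('E_P[fun w => expR (nu0 * X 1 w)%R] = 1)%E.

Definition mu_star X (nu0 : R) : \bar R :=
  ('E_P[fun w => (X 1 w * expR (nu0 * X 1 w))%R])%E.

(* When Pi is finite, the drift is gamma - \int_{|x| <= 1} x Pi(dx). *)
Definition compound_poisson (gamma sigma : R)
    (Pi : {measure set (measurableTypeR R) -> \bar R}) : Prop :=
  [/\ (Pi setT < +oo)%E, sigma = 0 &
      gamma - \int[Pi]_(x in `[-1, 1]%classic) (x : R) = 0].

Definition measure_support
    (Pi : {measure set (measurableTypeR R) -> \bar R}) : set R :=
  [set x | forall e, 0 < e -> (0 < Pi (ball x e))%E].

Definition lattice_set (A : set R) : Prop :=
  exists2 h : R, 0 < h & A `<=` range (fun k : int => k%:~R * h).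

End LevyProcess.

Section FirstPassage.
Context {d : measure_display} {T : measurableType d} {R : realType}.
Variables (P : probability T R) (X : R -> T -> R).

Definition running_sup (t : R) (w : T) : R :=
  sup [set X s w | s in `[0, t]%classic].

Definition last_max_time (t : R) (w : T) : R :=
  sup [set s : R | 0 <= s <= t /\ X s w = running_sup s w].

Definition passage_time (u : R) (w : T) : \bar R :=
  ereal_inf [set t%:E | t in [set t : R | 0 <= t /\ u < X t w]].

Definition passage (u : R) : set T := [set w | (passage_time u w < +oo)%E].

(* The next three are only used on the event [passage u], where the passage
   time is finite. *)
Definition tau (u : R) (w : T) : R := fine (passage_time u w).

Definition X_tau (u : R) (w : T) : R := X (tau u w) w.

Definition G_tau_left (u : R) (w : T) : R :=
  lim (last_max_time t w @[t --> (tau u w)^'-]).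

(* P is not assumed complete, and events involving last_max_time are in general
   only measurable for the completion of P.  The outer measure P^* coincides
   with P on measurable sets and with the completion of P on its domain.  For
   the same reason no measurability is needed below: the Lebesgue integral of a
   function that is measurable for the completion of P is the expected one. *)
Definition cond_proba (u : R) (A : set T) : R :=
  fine ((P^*)%mu (A `&` passage u)) / fine (P (passage u)).

Definition cond_expectation (u : R) (Z : T -> R) : \bar R :=
  ((\int[P]_(w in passage u) (Z w)%:E) * ((fine (P (passage u)))^-1)%:E)%E.

Definition cvg_in_cond_proba (Z : R -> T -> R) (z : R) : Prop :=
  forall e : R, 0 < e ->
    cond_proba u [set w | e < `|Z u w - z|] @[u --> +oo] --> (0 : R).

End FirstPassage.

(* Main.v *)
Require Import Defs.
From HB Require Import structures.
From mathcomp Require Import all_boot all_order all_algebra.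
From mathcomp Require Import all_classical all_reals all_analysis.
From mathcomp Require Import measurable_realfun.
From mathcomp Require Import ring lra.

Set Implicit Arguments.
Unset Strict Implicit.
Unset Printing Implicit Defensive.

Import Order.TTheory GRing.Theory Num.Theory.
Import numFieldNormedType.Exports.

Local Open Scope classical_set_scope.
Local Open Scope ring_scope.

(** The proof is an exponential change of measure.  Let [nu] be the exponent in
Cramer's condition, so that [expR (nu * X t)] is a martingale.  Weighting events
that are decided at time [t] with this martingale turns [X] into a process with
drift [mu], the tilted mean, and [0 < mu < +oo] ([tilted_mean_gt0]).  A tilted
path passes above [u] at a time close to [u / mu], and stays close to the line
of slope [mu] until then.  On the other hand the first passage above [u] has weight at least
[expR (nu * u)], so that

  [P (A `&` passage u) <= expR (- (nu * u)) * (tilted weight of A)]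

for an event [A] that is decided before the passage
([passed_change_of_measure]).  As soon as [P (passage u)] is itself at least a
constant times [expR (- (nu * u))], every event whose tilted weight tends to [0]
has a conditional probability that tends to [0].

The tilting is used through expectations weighted at a fixed time, first for
random walks, then for the restrictions of [X] to dyadic times;
right-continuity exhausts the passage events by passages at dyadic times
([crossed_bigcup], [passage_bigcup]).

The lower bound for [P (passage u)] ([passage_exponential_lower_bound]) amounts
to tightness of the overshoot of the tilted walk at integer times.  It follows
from a bounded Lyapunov function of the distance to the level, a mixture of
concave ramps over the law of the large jumps ([ramp_mean]), which is small
because these jumps contribute little to the finite mean [mu].

The deviations of the tilted process are one-sided.  To move more slowly than
[mu] is exponentially unlikely, by Chernoff's bound with exponents
[nu - theta < nu] ([chernoff_rate], [lower_deviation]).  To move faster is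
unlikely because the mean is [mu] and slow motion is already excluded
([upper_deviation]); an inequality of Ottaviani's type ([passed_le_end])
extends this from a fixed time to the supremum of the path.

Consequently, conditionally on a passage, [tau] is rarely larger than
[(mu^-1 + eps) * u] ([passage_time_late_negligible]), while the path is rarely
too fast, so that it attains new maxima shortly before the time [u / mu] without
having passed above [u]; this bounds the last maximum from below
([last_max_early_negligible]).  Since the last maximum precedes [tau], both
satisfy the same law of large numbers.  An overshoot of size [y] is a passage
above [u + y], of conditional probability at most a constant times
[expR (- (nu * y))].

For the conditional means the lower bounds follow from convergence in
probability, as all quantities are nonnegative.  The upper bounds come from
geometric tails of [tau] beyond [(mu^-1 + eps) * u] and of the overshoot
([integral_tau_le], [integral_X_tau_le]). *)

(** * Independence and the past of a random walk *)

Section IndependentTonelli.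
Context d d1 d2 (T : measurableType d) (T1 : measurableType d1)
  (T2 : measurableType d2) (R : realType) (P : probability T R).
Variables (Y : T -> T1) (Z : T -> T2).
Hypotheses (mY : measurable_fun setT Y) (mZ : measurable_fun setT Z).
Hypothesis indepYZ : forall A B, measurable A -> measurable B ->
  P (Y @^-1` A `&` Z @^-1` B) = (P (Y @^-1` A) * P (Z @^-1` B))%E.

Let Ypack : {mfun T >-> T1} := HB.pack Y (isMeasurableFun.Build _ _ _ _ _ mY).
Let Zpack : {mfun T >-> T2} := HB.pack Z (isMeasurableFun.Build _ _ _ _ _ mZ).
Let mYZ : measurable_fun setT (fun w => (Y w, Z w)).
Proof. exact: measurable_fun_pair. Qed.
Let YZpack : {mfun T >-> (T1 * T2)%type} :=
  HB.pack (fun w => (Y w, Z w)) (isMeasurableFun.Build _ _ _ _ _ mYZ).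

(** Independence makes the joint law of [Y] and [Z] the product of the marginal
laws, so Tonelli's theorem applies.  The range of [Y] is left arbitrary: below
it is the sample space itself with the sigma-algebra of the past. *)
Lemma independent_tonelli (f : T1 * T2 -> \bar R) :
  measurable_fun [set: T1 * T2] f -> (forall x, 0 <= f x)%E ->
  (\int[P]_w f (Y w, Z w) = \int[P]_w \int[P]_w' f (Y w, Z w'))%E.
Proof.
move=> mf f0.
have -> : (\int[P]_w f (Y w, Z w) = \int[distribution P YZpack]_x f x)%E.
  by rewrite ge0_integral_distribution.
have -> : (\int[distribution P YZpack]_x f x =
    \int[distribution P Ypack \x distribution P Zpack]_x f x)%E.
  apply: eq_measure_integral => A mA _.
  apply/esym/(@product_measure_unique _ _ _ _ _ (distribution P Ypack)
    (distribution P Zpack) (distribution P YZpack)) => //.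

rewrite fubini_tonelli1// ge0_integral_distribution//; last 2 first.
- exact: measurable_fun_fubini_tonelli_F.
- by move=> y; apply: integral_ge0.
apply: eq_integral => w _; rewrite /= /fubini_F ge0_integral_distribution//.
exact: measurableT_comp.
Qed.

End IndependentTonelli.

Record random_walk d (T : measurableType d) (R : realType)
    (P : probability T R) (S : nat -> T -> R) : Prop := RandomWalk {
  walk_measurable : forall n, measurable_fun setT (S n);
  walk_start : forall w, S 0%N w = 0;
  walk_independent : forall (n : nat) (B : nat -> set (measurableTypeR R)),
    (forall i, measurable (B i)) ->
    P [set w | forall i, (i < n)%N -> B i (S i.+1 w - S i w)] =
    (\prod_(i < n) P [set w | B i (S i.+1 w - S i w)%R])%E;
  walk_stationary : forall (n : nat) (B : set (measurableTypeR R)),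
    measurable B ->
    P [set w | B (S n.+1 w - S n w)] = P [set w | B (S 1%N w)] }.

Section Past.
Context d (T : measurableType d) (R : realType) (P : probability T R).
Variable S : nat -> T -> R.
Hypothesis hS : random_walk P S.

Definition past_rectangle n : set (set T) :=
  [set A | exists2 B : nat -> set (measurableTypeR R),
    forall i, measurable (B i) &
    A = [set w | forall i, (i < n)%N -> B i (S i.+1 w - S i w)]].

Definition past n : set (set T) := <<s past_rectangle n>>.

Lemma measurable_increment i : measurable_fun setT (fun w => S i.+1 w - S i w).
Proof. by apply: measurable_funB; exact: (walk_measurable hS). Qed.

Lemma past_rectangleP n (B : nat -> set (measurableTypeR R)) :
  [set w | forall i, (i < n)%N -> B i (S i.+1 w - S i w)] =
  \bigcap_(i in `I_n) ((fun w => S i.+1 w - S i w) @^-1` B i).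
Proof. by []. Qed.

Lemma past_rectangle_measurable n : past_rectangle n `<=` measurable.
Proof.
move=> _ [B mB ->]; rewrite past_rectangleP.
apply: bigcap_measurableType => i _.
by rewrite -[X in measurable X]setTI; apply: measurable_increment => //; exact: mB.
Qed.

Lemma past_measurable n A : past n A -> measurable A.
Proof.
apply: smallest_sub A; first exact: sigma_algebra_measurable.
exact: past_rectangle_measurable.
Qed.

Lemma past_rectangle_setI n : setI_closed (past_rectangle n).
Proof.
move=> _ _ [A mA ->] [B mB ->]; exists (fun i => A i `&` B i).
  by move=> i; exact: measurableI.
apply/seteqP; split=> [w [HA HB] i ilt|w H]; first by split; [exact: HA|exact: HB].
by split=> i ilt; have [] := H i ilt.
Qed.

Lemma past_rectangleT n : past_rectangle n setT.
Proof. by exists (fun=> setT) => //; apply/seteqP; split. Qed.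

Lemma past_mono m n A : (m <= n)%N -> past m A -> past n A.
Proof.
move=> mn; apply: smallest_sub A; first exact: smallest_sigma_algebra.
move=> _ [B mB ->]; apply: sub_sigma_algebra.
exists (fun i => if (i < m)%N then B i else setT).
  by move=> i; case: ifP.
apply/seteqP; split=> w H i ilt /=; first by case: ifP => // ?; apply: H.
by have := H i (leq_trans ilt mn); rewrite ilt.
Qed.

Lemma past_setT n : past n setT.
Proof. exact: (@measurableT _ (g_sigma_algebraType (past_rectangle n))). Qed.

Lemma past_setI n A B : past n A -> past n B -> past n (A `&` B).
Proof. exact: (@measurableI _ (g_sigma_algebraType (past_rectangle n))). Qed.

Lemma past_setC n A : past n A -> past n (~` A).
Proof. exact: (@measurableC _ (g_sigma_algebraType (past_rectangle n))). Qed.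

Lemma past_walk n k : (k <= n)%N ->
  measurable_fun [set: g_sigma_algebraType (past_rectangle n)] (S k).
Proof.
elim: k => [_|k IHk kn].
  rewrite (_ : S 0 = cst 0); first exact: measurable_cst.
  by apply/funext => w; rewrite /=; exact: (walk_start hS w).
rewrite (_ : S k.+1 = fun w => S k w + (S k.+1 w - S k w)); last first.
  by apply/funext => w; rewrite addrC subrK.
apply: measurable_funD; first exact: (IHk (ltnW kn)).
move=> _ B mB; rewrite setTI; apply: sub_sigma_algebra.
exists (fun i => if i == k then B else setT).
  by move=> i; case: ifP.
apply/seteqP; split=> w; first by move=> Bw i _; case: eqP => // ->.
by move=> /(_ k kn); rewrite eqxx.
Qed.

Lemma past_preimage n k (B : set (measurableTypeR R)) : (k <= n)%N ->
  measurable B -> past n (S k @^-1` B).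
Proof. by move=> kn mB; rewrite -[X in past n X]setTI; apply: (past_walk kn). Qed.

(** The rectangles generate the past and are stable under intersection, so two
finite measures that agree on them agree on the past. *)
Lemma past_independent n A (B : set (measurableTypeR R)) :
  past n A -> measurable B ->
  P (A `&` [set w | B (S n.+1 w - S n w)]) =
  (P A * P [set w | B (S 1%N w)])%E.
Proof.
move=> pA mB; pose E := [set w | B (S n.+1 w - S n w)].
have mE : measurable E.
  by rewrite -[X in measurable X]setTI; apply: measurable_increment.
have PE : P E = P [set w | B (S 1%N w)] by exact: (walk_stationary hS).
have PEfin : P E \is a fin_num by exact: fin_num_measure.
have p0 : 0 <= fine (P E) by rewrite fine_ge0.
rewrite -PE -(fineK PEfin) muleC.
change (mrestr P mE A = mscale (NngNum p0) P A).
apply: (g_sigma_algebra_measure_unique (past_rectangle n) _ (fun=> setT)) pA.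
- exact: past_rectangle_measurable.
- by move=> _; exact: past_rectangleT.
- by apply/seteqP; split=> // x _; exists 0%N.
- exact: past_rectangle_setI.
- move=> _ [C mC ->]; 
  change (P ([set w | forall i, (i < n)%N -> C i (S i.+1 w - S i w)] `&` E) =
    ((fine (P E))%:E *
     P [set w | forall i, (i < n)%N -> C i (S i.+1 w - S i w)%R])%E).
  rewrite fineK//.
  pose D i := if (i < n)%N then C i else if i == n then B else setT.
  have mD i : measurable (D i) by rewrite /D; case: ifP => // _; case: ifP.
  transitivity (P [set w | forall i, (i < n.+1)%N -> D i (S i.+1 w - S i w)]).
    congr (P _); apply/seteqP; split=> w /=.
      move=> [Cw Ew] i; rewrite ltnS leq_eqVlt => /orP[/eqP->|ilt].
        by rewrite /D ltnn eqxx.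
      by rewrite /D ilt; apply: Cw.
    move=> Dw; split; last by have := Dw n (ltnSn n); rewrite /D ltnn eqxx.
    by move=> i ilt; have := Dw i (ltnW ilt); rewrite /D ilt.
  rewrite (walk_independent hS)// big_ord_recr/= muleC; congr (_ * _)%E.
    by rewrite /D ltnn eqxx.
  rewrite (walk_independent hS)//; apply: eq_bigr => i _.
  by rewrite /D ltn_ord.
- move=> _; change (P (setT `&` E) < +oo)%E.
  by rewrite setTI ltey_eq PEfin.
Qed.

(** The Markov property in the only form that is used: on an event of the past,
the next increment may be integrated out with an independent copy of the first
one. *)
Lemma past_tonelli n A (f : R * R -> \bar R) :
  past n A -> measurable_fun [set: R * R] f -> (forall x, 0 <= f x)%E ->
  (\int[P]_(w in A) f (S n w, S n.+1 w - S n w)%R =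
   \int[P]_(w in A) \int[P]_w' f (S n w, S 1%N w'))%E.
Proof.
move=> pA mf f0; have mA := past_measurable pA.
pose F : measurableType _ := g_sigma_algebraType (past_rectangle n).
(* The past enters as the identity map into the coarser measurable space [F];
   the indicator of [A] is absorbed in the integrand. *)
pose Y : T -> F := id.
have mY : measurable_fun setT Y.
  by move=> _ B mB; rewrite setTI; exact: past_measurable mB.
pose g (x : F * R) : \bar R := ((\1_A x.1 : R)%:E * f (S n x.1, x.2))%E.
have mg : measurable_fun [set: F * R] g.
  apply: emeasurable_funM.
    apply/measurable_EFinP; apply: (measurableT_comp (f := \1_A : F -> R)).
      exact: (@measurable_indic _ F).
    exact: measurable_fst.
  apply: (measurableT_comp mf); apply: measurable_fun_pair.
    apply: (measurableT_comp (f := S n : F -> R)); last exact: measurable_fst.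
    exact: past_walk.
  exact: measurable_snd.
have g0 x : (0 <= g x)%E by apply: mule_ge0; rewrite ?lee_fin.
have mZ := measurable_increment n.
have indep B (C : set (measurableTypeR R)) : measurable B -> measurable C ->
    P (Y @^-1` B `&` (fun w => S n.+1 w - S n w) @^-1` C) =
    (P (Y @^-1` B) * P ((fun w => S n.+1 w - S n w)%R @^-1` C))%E.
  move=> mB mC; have := past_independent mB mC.
  by rewrite -(walk_stationary hS n mC).
have S1E (h : R -> \bar R) : measurable_fun setT h -> (forall x, 0 <= h x)%E ->
   (\int[P]_w h (S n.+1 w - S n w)%R = \int[P]_w h (S 1%N w))%E.
  move=> mh h0.
  have mS1 := walk_measurable hS 1%N.
  pose X1 : {mfun T >-> R} := 
    HB.pack (fun w => S n.+1 w - S n w) (isMeasurableFun.Build _ _ _ _ _ mZ).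
  pose X2 : {mfun T >-> R} := 
    HB.pack (S 1%N) (isMeasurableFun.Build _ _ _ _ _ mS1).
  rewrite -(ge0_integral_distribution X1)// -(ge0_integral_distribution X2)//.
  by apply: eq_measure_integral => B mB _; exact: (walk_stationary hS).
have := independent_tonelli mY mZ indep mg g0.
rewrite /g /Y/=.
have ptc (h : T -> \bar R) :
    (\int[P]_(w in A) h w = \int[P]_w ((\1_A w : R)%:E * h w))%E.
  rewrite integral_mkcond; apply: eq_integral => w _.
  by rewrite patchE indicE; case: ifP; rewrite ?mul1e ?mul0e.
rewrite -ptc => ->; rewrite [RHS]ptc; apply: eq_integral => w _.
rewrite ge0_integralZl//; last first.
  apply: measurableT_comp => //.
  apply: measurable_fun_pair => //.
congr (_ * _)%E; apply: (S1E (fun z => f (S n w, z))) => //.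
exact: measurableT_comp.
Qed.

End Past.

(** * Exponential moments and change of measure for random walks *)

Section ExponentialMoments.
Context d (T : measurableType d) (R : realType) (P : probability T R).
Variable S : nat -> T -> R.
Hypothesis hS : random_walk P S.

Lemma measurable_expR_walk (a : R) n (A : set T) :
  measurable_fun A (fun w => (expR (a * S n w))%:E).
Proof.
apply: (@measurable_funTS _ _ _ _ A); apply/measurable_EFinP.
apply: measurableT_comp => //; apply: measurable_funM => //.
exact: (walk_measurable hS).
Qed.

Lemma measurable_walk_gt (u : R) k : measurable [set w | u < S k w].
Proof.
have -> : [set w | u < S k w] = S k @^-1` `]u, +oo[.
  by apply/seteqP; split=> w /=; rewrite in_itv/= andbT.
by rewrite -[X in measurable X]setTI; apply: (walk_measurable hS).
Qed.

Lemma exp_moment_step (a : R) n A : past S n A ->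
  (\int[P]_(w in A) (expR (a * S n.+1 w))%:E =
   (\int[P]_(w in A) (expR (a * S n w))%:E) *
   (\int[P]_w (expR (a * S 1%N w))%:E))%E.
Proof.
move=> pA; have mA := past_measurable hS pA.
pose f (x : R * R) : \bar R := (expR (a * (x.1 + x.2)))%:E.
have mf : measurable_fun [set: R * R] f.
  apply/measurable_EFinP; apply: measurableT_comp => //.
  by apply: measurable_funM => //; apply: measurable_funD.
have f0 x : (0 <= f x)%E by rewrite lee_fin expR_ge0.
have := past_tonelli hS pA mf f0; rewrite /f /=.
under eq_integral do rewrite addrC subrK.
move=> ->; rewrite -ge0_integralZr//; last 2 first.
- exact: measurable_expR_walk.
- by apply: integral_ge0 => w _; rewrite lee_fin expR_ge0.
apply: eq_integral => w _.
under eq_integral do rewrite mulrDr expRD EFinM.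
rewrite ge0_integralZl//; exact: measurable_expR_walk.
Qed.

Lemma exp_moment_walk (a : R) n :
  (\int[P]_w (expR (a * S n w))%:E =
   (\int[P]_w (expR (a * S 1%N w))%:E) ^+ n)%E.
Proof.
elim: n => [|n IHn].
  under eq_integral do rewrite (walk_start hS) mulr0 expR0.
  by rewrite integral_cst// mul1e expe0; exact: probability_setT.
by rewrite (exp_moment_step a (@past_setT _ _ _ S n)) IHn expeS muleC.
Qed.

Section Tilting.
Variable nu : R.
Hypothesis nu_gt0 : 0 < nu.
Hypothesis cramer : (\int[P]_w (expR (nu * S 1%N w))%:E = 1)%E.

(** [expR (nu * S n)] is a martingale, so the tilted weight of an event of the
past does not depend on the later time at which it is computed. *)
Lemma tilt_martingale n N A : (n <= N)%N -> past S n A ->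
  (\int[P]_(w in A) (expR (nu * S N w))%:E =
   \int[P]_(w in A) (expR (nu * S n w))%:E)%E.
Proof.
move=> /subnK <- pA; elim: (N - n)%N => // k IHk.
rewrite addSn exp_moment_step ?cramer ?mule1//.
by apply: past_mono pA; rewrite leq_addl.
Qed.

Lemma tilt_le1 N A : measurable A ->
  (\int[P]_(w in A) (expR (nu * S N w))%:E <= 1)%E.
Proof.
move=> mA; apply: (@le_trans _ _ (\int[P]_w (expR (nu * S N w))%:E)%E).
  apply: ge0_subset_integral => //; first exact: measurable_expR_walk.
by rewrite exp_moment_walk cramer -EFin_expe expr1n.
Qed.

Definition passed (u : R) n : set T :=
  [set w | exists2 k, (k <= n)%N & u < S k w].

Definition first_passage (u : R) k : set T :=
  [set w | u < S k w] `&` [set w | forall j, (j < k)%N -> S j w <= u].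

Lemma past_walk_gt (u : R) n k : (k <= n)%N -> past S n [set w | u < S k w].
Proof.
move=> kn; have -> : [set w | u < S k w] = S k @^-1` `]u, +oo[.
  by apply/seteqP; split=> w /=; rewrite in_itv/= andbT.
by apply: (past_preimage hS kn); exact: measurable_itv.
Qed.

Lemma passed0 u : passed u 0 = [set w | u < S 0%N w].
Proof.
apply/seteqP; split=> [w [k]|w uw]; last by exists 0%N.
by rewrite leqn0 => /eqP ->.
Qed.

Lemma passedS u n : passed u n.+1 = passed u n `|` [set w | u < S n.+1 w].
Proof.
apply/seteqP; split=> [w [k]|w [[k kn uw]|uw]].
- by rewrite leq_eqVlt => /orP[/eqP->|]; [right|left; exists k].
- by exists k => //; apply: leqW.
- by exists n.+1.
Qed.

Lemma past_passed (u : R) n N : (n <= N)%N -> past S N (passed u n).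
Proof.
elim: n => [|n IHn] nN; first by rewrite passed0; apply: past_walk_gt.
rewrite passedS; apply: (@measurableU _ (g_sigma_algebraType (past_rectangle S N))).
  exact: IHn (ltnW nN).
exact: past_walk_gt.
Qed.

Lemma first_passage0 u : first_passage u 0 = [set w | u < S 0%N w].
Proof. by apply/seteqP; split=> [w []|w ?]; [|split]. Qed.

Lemma first_passageS u n :
  first_passage u n.+1 = [set w | u < S n.+1 w] `&` ~` passed u n.
Proof.
apply/seteqP; split=> w [uw H]; split=> //.
  by move=> [k kn]; rewrite ltNge H.
by move=> j jn; rewrite leNgt; apply/negP => uj; apply: H; exists j.
Qed.

Lemma past_first_passage (u : R) k : past S k (first_passage u k).
Proof.
case: k => [|k]; first by rewrite first_passage0; exact: past_walk_gt.
rewrite first_passageS; apply: past_setI; first exact: past_walk_gt.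
by apply: past_setC; exact: past_passed.
Qed.

Lemma passed_disjU u n :
  passed u n.+1 = passed u n `|` first_passage u n.+1.
Proof.
rewrite passedS first_passageS; apply/seteqP.
by split=> w /=; have [] := pselect (passed u n w); tauto.
Qed.

(** Wald's exponential change of measure at the first passage above [u].  On
[first_passage u k] the weight [expR (nu * S k)] is at least [expR (nu * u)],
and by the martingale property it may be replaced by [expR (nu * S M)].  The
hypothesis on [A] says that on each [first_passage u k] it is decided by the
path up to time [k]. *)
Lemma passed_change_of_measure (u : R) N A :
  (forall k, (k <= N)%N -> past S k (A `&` first_passage u k)) ->
  forall M, (N <= M)%N ->
  ((expR (nu * u))%:E * P (A `&` passed u N) <=
   \int[P]_(w in A `&` passed u N) (expR (nu * S M w))%:E)%E.
Proof.
move=> pA M NM.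
have first k : (k <= N)%N ->
    ((expR (nu * u))%:E * P (A `&` first_passage u k) <=
     \int[P]_(w in A `&` first_passage u k) (expR (nu * S M w))%:E)%E.
  move=> kN; have pk := pA k kN; have mk := past_measurable hS pk.
  rewrite (tilt_martingale (leq_trans kN NM) pk) -integral_cst//.
  apply: ge0_le_integral => //.
  - by move=> w _; rewrite lee_fin expR_ge0.
  - exact: measurable_expR_walk.
  - by move=> w [_ [/= uw _]]; rewrite lee_fin ler_expR ler_pM2l// ltW.
elim: N pA NM first => [|N IHN] pA NM first.
  rewrite passed0 -first_passage0; exact: first.
have {}IHN := IHN (fun k kN => pA k (leqW kN)) (ltnW NM)
  (fun k kN => first k (leqW kN)).
have mP k : (k <= N)%N -> measurable (A `&` passed u k).
  elim: k => [|k IHk] kN.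
    rewrite passed0 -first_passage0.
    exact: (past_measurable hS (pA 0%N _)).
  rewrite passed_disjU setIUr; apply: measurableU; first exact/IHk/ltnW.
  by apply: (past_measurable hS); apply: pA; exact: leqW.
have mD : measurable (A `&` first_passage u N.+1).
  exact: (past_measurable hS (pA N.+1 _)).
have D0 : (A `&` passed u N) `&` (A `&` first_passage u N.+1) = set0.
  by rewrite first_passageS; apply/seteqP; split=> // w [[_ ?] [_ []]].
rewrite passed_disjU setIUr measureU//; [|exact: mP..].
rewrite ge0_integral_setU//;
  [|exact: mP|exact: measurable_expR_walk|by rewrite disj_set2E D0].
rewrite ge0_muleDr//; apply: leeD => //; exact: first.
Qed.

End Tilting.

End ExponentialMoments.

(** * Integrable functions with a known mean *)

Section HasMean.
Context d (T : measurableType d) (R : realType) (P : probability T R).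
Implicit Types f g : T -> R.

(** Integrability together with the value of the integral.  As this relation is
stable under linear combinations, means of explicit functions are computed in
the reals, without extended arithmetic. *)
Definition has_mean f (m : R) : Prop :=
  P.-integrable setT (EFin \o f) /\ (\int[P]_w (f w)%:E = m%:E)%E.

Lemma has_mean_measurable f m : has_mean f m -> measurable_fun setT f.
Proof. by move=> [/measurable_int/measurable_EFinP]. Qed.

Lemma has_mean_cst (c : R) : has_mean (fun=> c) c.
Proof.
split; first exact: finite_measure_integrable_cst.
by rewrite integral_cst//= -[RHS]mule1; congr (_ * _)%E; exact: probability_setT.
Qed.

Lemma has_meanD f g m n : has_mean f m -> has_mean g n ->
  has_mean (fun w => f w + g w) (m + n).
Proof.
move=> [fi fm] [gi gn]; split.
  by apply: eq_integrable (integrableD measurableT fi gi).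
by rewrite integralD_EFin// fm gn.
Qed.

Lemma has_meanZ (c : R) f m : has_mean f m ->
  has_mean (fun w => c * f w) (c * m).
Proof.
move=> [fi fm]; split.
  by apply: eq_integrable (integrableZl measurableT c fi).
by under eq_integral do rewrite EFinM; rewrite integralZl// fm.
Qed.

Lemma has_meanB f g m n : has_mean f m -> has_mean g n ->
  has_mean (fun w => f w - g w) (m - n).
Proof.
move=> hf hg; have := has_meanD hf (has_meanZ (-1) hg).
rewrite mulN1r (_ : (fun w => _) = (fun w => f w - g w))//.
by apply/funext => w; rewrite mulN1r.
Qed.

Lemma has_mean_le f g m n : has_mean f m -> has_mean g n ->
  (forall w, f w <= g w) -> m <= n.
Proof.
move=> [fi fm] [gi gn] fg; rewrite -lee_fin -fm -gn.
by apply: le_integral => // w _; rewrite lee_fin.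
Qed.

Lemma has_mean_unique f m n : has_mean f m -> has_mean f n -> m = n.
Proof. by move=> [_ fm] [_]; rewrite fm => -[]. Qed.

Lemma has_mean_exists f : P.-integrable setT (EFin \o f) ->
  has_mean f (fine (\int[P]_w (f w)%:E)%E).
Proof. by move=> fi; split=> //; rewrite fineK//; exact: integrable_fin_num. Qed.

Lemma has_mean_dominated f g m : measurable_fun setT f ->
  (forall w, `|f w| <= g w) -> has_mean g m -> exists n, has_mean f n.
Proof.
move=> mf fg [gi _]; eexists; apply: has_mean_exists.
apply: (le_integrable measurableT _ _ gi); first exact/measurable_EFinP.
by move=> w _ /=; rewrite lee_fin (le_trans (fg w))// ler_norm.
Qed.

Lemma has_mean_ge0_integral f m : (forall w, 0 <= f w) ->
  measurable_fun setT f -> (\int[P]_w (f w)%:E = m%:E)%E -> has_mean f m.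
Proof.
move=> f0 mf fm; split=> //; apply/integrableP; split; first exact/measurable_EFinP.
by under eq_integral do rewrite /= ger0_norm//; rewrite fm ltry.
Qed.

Lemma integral_indic_mean (A : set T) f : measurable A ->
  (\int[P]_(w in A) (f w)%:E = \int[P]_w (f w * \1_A w)%:E)%E.
Proof.
move=> mA; rewrite integral_mkcond; apply: eq_integral => w _.
by rewrite patchE indicE; case: ifP; rewrite ?mulr1 ?mulr0.
Qed.

Lemma has_mean_indic f m (A : set T) : measurable A -> has_mean f m ->
  exists2 n, has_mean (fun w => f w * \1_A w) n &
    (\int[P]_(w in A) (f w)%:E = n%:E)%E.
Proof.
move=> mA [fi fm]; have fA := integrableS measurableT mA (@subsetT _ _) fi.
have fAfin := integrable_fin_num mA fA.
exists (fine (\int[P]_(w in A) (f w)%:E)%E); last by rewrite fineK.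
split; last by rewrite fineK// -integral_indic_mean.
have /integrable_mkcond := fA; move=> /(_ mA).
by apply: eq_integrable => // w _; rewrite patchE/= indicE;
  case: ifP; rewrite ?mulr1 ?mulr0.
Qed.

Lemma has_mean_dominated_cvg (f : nat -> T -> R) (g h : T -> R) (m : R) :
  (forall n, measurable_fun setT (f n)) -> measurable_fun setT g ->
  (forall w, f n w @[n --> \oo] --> g w) ->
  (forall n w, `|f n w| <= h w) -> has_mean h m ->
  exists v l, [/\ (forall n, has_mean (f n) (v n)), has_mean g l &
    v n @[n --> \oo] --> l].
Proof.
move=> mf mg fg fh hh.
have fm n : has_mean (f n) (fine (\int[P]_w (f n w)%:E)%E).
  by have [? [? _]] := has_mean_dominated (mf n) (fh n) hh; exact: has_mean_exists.
have fgE w : (EFin \o f n) w @[n --> \oo] --> (EFin \o g) w.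
  by apply: cvg_EFin; [exact: nearW|exact: fg].
have [gi _ cv] := @dominated_convergence _ _ _ P setT measurableT
  (fun n => EFin \o f n) (EFin \o g) (EFin \o h)
  (fun n => (measurable_EFinP _ _).2 (mf n)) ((measurable_EFinP _ _).2 mg)
  (aeW _ (fun w _ => fgE w)) hh.1
  (aeW _ (fun w n _ => fh n w)).
exists (fun n => fine (\int[P]_w (f n w)%:E)%E), (fine (\int[P]_w (g w)%:E)%E).
split=> //; first exact: has_mean_exists.
by apply: fine_cvg; rewrite fineK//; exact: integrable_fin_num.
Qed.


End HasMean.

(** * The tilted law of one increment *)

Section TiltedLaw.
Context d (T : measurableType d) (R : realType) (P : probability T R).
Variables (xi : T -> R) (nu mu : R).
Hypotheses (mxi : measurable_fun setT xi) (nu_gt0 : 0 < nu).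
Hypothesis tilt1 : has_mean P (fun w => expR (nu * xi w)) 1.
Hypothesis tilt_mean : has_mean P (fun w => xi w * expR (nu * xi w)) mu.

Lemma has_mean_norm (f : T -> R) m : has_mean P f m ->
  exists n, has_mean P (fun w => `|f w|) n.
Proof.
by move=> [fi _]; eexists; apply: has_mean_exists; exact: integrable_norm.
Qed.

Lemma le_expR (x : R) : x <= expR x.
Proof. by apply: le_trans (expR_ge1Dx x); rewrite lerDr. Qed.

Lemma measurable_tilt (c : R) : measurable_fun setT (fun w => expR (c * xi w)).
Proof. by apply: measurableT_comp => //; exact: measurable_funM. Qed.

(** Under the tilted law the increment has mean [mu], so for small [theta] the
tilted Laplace transform at [theta] of [xi - a] is less than [1]: its
derivative at [0] is [a - mu < 0].  The bound [expR (- y) <= 1 - y * expR (- y)]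
replaces the derivative by the limit of [z * expR (- (theta * z))] under the
integral sign, which dominated convergence gives. *)
Lemma chernoff_rate (a : R) : a < mu -> exists theta rho : R,
  [/\ 0 < theta < nu, has_mean P (fun w => expR ((nu - theta) * xi w)) rho &
      expR (theta * a) * rho < 1].
Proof.
move=> amu; pose z w := xi w - a.
have mz : measurable_fun setT z by exact: measurable_funB.
pose th (n : nat) : R := nu / 2 / n.+1%:R.
have th_gt0 n : 0 < th n by rewrite !divr_gt0.
have th_le n : th n <= nu / 2.
  by rewrite ler_pdivrMr// ler_peMr ?ler1n// divr_ge0// ltW.
pose f n w := expR (nu * xi w) * (z w * expR (- (th n * z w))).
pose g w := expR (nu * xi w) * z w.
have mf n : measurable_fun setT (f n).
  apply: measurable_funM; first exact: measurable_tilt.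
  apply: measurable_funM => //; apply: measurableT_comp => //.
  by apply: measurableT_comp => //; exact: measurable_funM.
have mg : measurable_fun setT g.
  by apply: measurable_funM => //; exact: measurable_tilt.
have gmean : has_mean P g (mu - a).
  have := has_meanB tilt_mean (has_meanZ a tilt1); rewrite mulr1.
  rewrite (_ : (fun w => _) = g)//; apply/funext => w.
  by rewrite /g /z; ring.
have [m1 hm1] := has_mean_norm tilt_mean.
have hh := has_meanD (has_meanD hm1 (has_meanZ `|a| tilt1))
  (has_mean_cst P (2 / nu * expR (nu * a))).
have fh n w : `|f n w| <= `|xi w * expR (nu * xi w)| +
    `|a| * expR (nu * xi w) + 2 / nu * expR (nu * a).
  rewrite !normrM !(ger0_norm (expR_ge0 _)).
  (* For [z < 0] the factor [expR (- (theta * z))] is absorbed by half of the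
     exponent [nu * z], because [theta <= nu / 2]. *)
  have [z0|z0] := leP 0 (z w).
    have H1 : expR (- (th n * z w)) <= 1.
      by rewrite -expR0 ler_expR oppr_le0 mulr_ge0// ltW.
    have H2 : `|z w| <= `|xi w| + `|a| by exact: ler_normB.
    have H3 : 0 <= 2 / nu * expR (nu * a).
      by rewrite mulr_ge0 ?expR_ge0// divr_ge0// ltW.
    apply: (@le_trans _ _ (expR (nu * xi w) * (`|xi w| + `|a|))).
      apply: ler_wpM2l; first exact: expR_ge0.
      by apply: le_trans H2; rewrite ler_piMr.
    by rewrite mulrDr mulrC [X in _ + X <= _]mulrC lerDl.
  apply: (@le_trans _ _ (2 / nu * expR (nu * a))); last first.
    by rewrite lerDr addr_ge0// ?mulr_ge0// ?expR_ge0.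
  have -> : nu * xi w = nu * a + nu * z w by rewrite /z; ring.
  rewrite expRD ltr0_norm// [leRHS]mulrC -[leLHS]mulrA.
  apply: ler_wpM2l; first exact: expR_ge0.
  rewrite mulrCA -expRD.
  have H : - z w * (nu / 2) <= expR (- z w * (nu / 2)) by exact: le_expR.
  have H' : expR (nu * z w - th n * z w) <= expR (z w * (nu / 2)).
    by rewrite ler_expR; have := th_le n; nra.
  apply: (@le_trans _ _ (- z w * expR (z w * (nu / 2)))).
    by rewrite ler_wpM2l// oppr_ge0 ltW.
  have -> : 2 / nu = 2 / nu * (expR (- z w * (nu / 2)) * expR (z w * (nu / 2))).
    by rewrite -expRD mulNr addNr expR0 mulr1.
  rewrite [leRHS]mulrA; apply: ler_wpM2r; first exact: expR_ge0.
  rewrite -ler_pdivrMl ?divr_gt0// invf_div; apply: le_trans H.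
  by rewrite mulrC.
have fg w : f n w @[n --> \oo] --> g w.
  rewrite /f /g; apply: cvgMr; rewrite -[X in _ --> X]mulr1; apply: cvgMr.
  rewrite -expR0; apply: continuous_cvg; first exact: continuous_expR.
  rewrite -[X in _ --> X]oppr0; apply: cvgN.
  rewrite -[X in _ --> X](mul0r (z w)); apply: cvgMl.
  rewrite -[X in _ --> X](mulr0 (nu / 2)); apply: cvgMr.
  exact: cvg_harmonic.
have [v [l [fv gl vl]]] := has_mean_dominated_cvg mf mg fg fh hh.
have l0 : 0 < l by rewrite -(has_mean_unique gmean gl) subr_gt0.
have [n vn] : exists n, 0 < v n.
  have /cvgr_gt/(_ 0 l0) := vl.
  by move=> [N _ /(_ N (leqnn N))] /= ?; exists N.
have [rho hrho] : exists rho,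
    has_mean P (fun w => expR ((nu - th n) * xi w)) rho.
  apply: (has_mean_dominated (g := fun w => 1 + expR (nu * xi w))
    _ _ (has_meanD (has_mean_cst P 1) tilt1)); first exact: measurable_tilt.
  move=> w; rewrite ger0_norm ?expR_ge0//.
  have := th_le n; have := th_gt0 n; move=> t0 t1.
  have [x0|x0] := leP 0 (xi w).
    apply: (@le_trans _ _ (expR (nu * xi w))); last by rewrite lerDr.
    by rewrite ler_expR; nra.
  apply: (@le_trans _ _ 1); last by rewrite lerDl expR_ge0.
  by rewrite -expR0 ler_expR; nra.
exists (th n), rho; split => //.
  by rewrite th_gt0/= (le_lt_trans (th_le n))// ltr_pdivrMr// ltr_pMr// ltr1n.
have H1 := has_meanZ (expR (th n * a)) hrho.
have H2 := has_meanB tilt1 (has_meanZ (th n) (fv n)).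
apply: (@le_lt_trans _ _ (1 - th n * v n)); last by rewrite gtrBl mulr_gt0.
apply: (has_mean_le H1 H2) => w.
rewrite -expRD /f.
have -> : th n * a + (nu - th n) * xi w = nu * xi w - th n * z w.
  by rewrite /z; ring.
rewrite expRD mulrCA -{2}(mulr1 (expR _)) -mulrBr.
apply: ler_wpM2l; first exact: expR_ge0.
have := expR_ge1Dx (th n * z w).
have e0 := expR_gt0 (- (th n * z w)).
have e1 : expR (th n * z w) * expR (- (th n * z w)) = 1.
  by rewrite -expRD subrr expR0.
move: e1; rewrite mulrA; nra.
Qed.

Lemma measurable_gt_indicator (c : R) :
  measurable_fun setT (fun w => (c < xi w)%R%:R : R).
Proof.
rewrite (_ : (fun w => _) = \1_(xi @^-1` `]c, +oo[)); last first.
  apply/funext => w; rewrite indicE; congr ((nat_of_bool _)%:R).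
  by apply/idP/idP; rewrite inE/= in_itv/= andbT.
by apply: measurable_indic; rewrite -[X in measurable X]setTI; exact: mxi.
Qed.

Lemma upper_tail_mean_small (eps : R) : 0 < eps -> exists K r : R,
  [/\ 0 < K, has_mean P (fun w => xi w * expR (nu * xi w) * (K < xi w)%R%:R) r &
      r < eps].
Proof.
move=> eps0.
pose f (n : nat) w : R := xi w * expR (nu * xi w) * (n.+1%:R < xi w)%R%:R.
have mf n : measurable_fun setT (f n).
  apply: measurable_funM; last exact: measurable_gt_indicator.
  by apply: measurable_funM => //; exact: measurable_tilt.
have [m1 hm1] := has_mean_norm tilt_mean.
have fcvg w : f n w @[n --> \oo] --> (0 : R).
  apply: cvg_near_cst; near=> n.
  rewrite /f ltNge (_ : xi w <= n.+1%:R) ?mulr0//.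
  apply: (@le_trans _ _ n%:R); last by rewrite ler_nat.
  by near: n; exact: nbhs_infty_ger.
have fle n w : `|f n w| <= `|xi w * expR (nu * xi w)|.
  by rewrite normrM normr_nat; case: (_ < _); rewrite ?mulr1// mulr0.
have m0 : measurable_fun setT (fun _ : T => 0 : R) by [].
have [v [l [fv gl vl]]] := has_mean_dominated_cvg mf m0 fcvg fle hm1.
have l0 : l = 0 by exact: has_mean_unique gl (has_mean_cst P 0).
have /cvgr_lt/(_ eps) := vl; rewrite l0 => /(_ eps0) [N _ /(_ N (leqnn N)) vN].
by exists N.+1%:R, (v N); split=> //; exact: fv.
Unshelve. all: by end_near. Qed.

End TiltedLaw.

(** * A Lyapunov function controlling the overshoot *)

Section OvershootLyapunov.
Context d (T : measurableType d) (R : realType) (P : probability T R).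
Variables (xi : T -> R) (nu : R).
Hypotheses (mxi : measurable_fun setT xi) (nu_gt0 : 0 < nu).
Hypothesis tilt1 : has_mean P (fun w => expR (nu * xi w)) 1.
Variables (K r a theta rho : R).
Hypotheses (K_gt0 : 0 < K) (a_gt0 : 0 < a).
Hypothesis tail_mean :
  has_mean P (fun w => xi w * expR (nu * xi w) * (K < xi w)%R%:R) r.
Hypothesis truncated_mean :
  has_mean P (fun w => Num.min (xi w) K * expR (nu * xi w)) a.
Hypothesis exp_mean : has_mean P (fun w => expR ((nu - theta) * xi w)) rho.

Definition ramp (eta y : R) : R := Num.min eta (Num.max (y + K) 0).

(** The ramp vanishes up to [-K], then has slope [1] up to [eta - K], where it
becomes constant.  If [eta] exceeds [y + K], a step [x] to the left from [y]
loses [x], or at least [K] if it ends below [-K], because [0 <= y]. *)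
Lemma ramp_step (eta x y : R) : 0 <= y -> K < eta ->
  ramp eta (y - x) <= ramp eta y - Num.min x K * (y + K < eta)%R%:R.
Proof.
move=> y0 Keta; rewrite /ramp.
have yK : 0 <= y + K by rewrite addr_ge0// ltW.
have [ltye|leey] := ltP (y + K) eta.
  rewrite mulr1 (max_l yK) (min_r (ltW ltye)).
  rewrite ge_min; apply/orP; right; rewrite ge_max; apply/andP; split.
    by rewrite addrAC lerD2l lerN2 ge_min lexx.
  by rewrite subr_ge0 ge_min; apply/orP; right; rewrite lerDr.
by rewrite mulr0 subr0 (max_l yK) (min_l leey) ge_min lexx.
Qed.

Lemma ramp_ge0 eta y : 0 <= eta -> 0 <= ramp eta y.
Proof. by move=> e0; rewrite /ramp le_min e0 le_max lexx orbT. Qed.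

Lemma ramp_le eta y : ramp eta y <= eta.
Proof. by rewrite /ramp ge_min lexx. Qed.

Lemma ramp_homo eta : {homo ramp eta : y z / y <= z}.
Proof.
move=> y z yz; rewrite /ramp le_min ge_min lexx/= ge_min; apply/orP; right.
by rewrite ge_max !le_max lexx lerD2r yz orbT.
Qed.

Definition ramp_weight (y : R) (w : T) : R :=
  expR (nu * xi w) * (K < xi w)%R%:R * ramp (xi w) y.

(** The mixture of the ramps over the tilted law of the jumps [eta > K].  With [y]
the distance to the level, its decrease in one tilted step is at least [a] times
the tilted probability of a jump larger than [y + K], that is, of a passage with
overshoot larger than [K].  Hence it bounds [a] times the total probability of
such a passage. *)
Definition ramp_mean (y : R) : R := fine (\int[P]_w (ramp_weight y w)%:E)%E.

Lemma ramp_weightP y : has_mean P (ramp_weight y) (ramp_mean y).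
Proof.
suff [n [hi _]] : exists n, has_mean P (ramp_weight y) n by exact: has_mean_exists.
apply: has_mean_dominated tail_mean.
  apply: measurable_funM.
    apply: measurable_funM; first exact: measurable_tilt.
    exact: measurable_gt_indicator.
  exact: measurable_minr.
move=> w; rewrite /ramp_weight; have [Kx|_] := ltP K (xi w); last first.
  by rewrite !mulr0 mul0r normr0.
have x0 := ltW (lt_trans K_gt0 Kx).
rewrite !mulr1 normrM !ger0_norm ?expR_ge0 ?ramp_ge0// mulrC.
by apply: ler_wpM2r; [exact: expR_ge0|exact: ramp_le].
Qed.

Lemma ramp_mean_ge0 y : 0 <= ramp_mean y.
Proof.
apply: (has_mean_le (has_mean_cst P 0) (ramp_weightP y)) => w.
rewrite /ramp_weight; have [Kx|_] := ltP K (xi w); last by rewrite mulr0 mul0r.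
by rewrite mulr1 mulr_ge0 ?expR_ge0// ramp_ge0// ltW// (lt_trans K_gt0).
Qed.

Lemma ramp_mean_le y : ramp_mean y <= r.
Proof.
apply: (has_mean_le (ramp_weightP y) tail_mean) => w.
rewrite /ramp_weight; have [Kx|_] := ltP K (xi w); last by rewrite !mulr0 mul0r.
by rewrite !mulr1 mulrC ler_wpM2r ?expR_ge0// ramp_le.
Qed.

Lemma ramp_mean_homo : {homo ramp_mean : y z / y <= z}.
Proof.
move=> y z yz; apply: (has_mean_le (ramp_weightP y) (ramp_weightP z)) => w.
by rewrite ler_wpM2l ?ramp_homo// mulr_ge0// expR_ge0.
Qed.

Lemma measurable_ramp_mean : measurable_fun setT ramp_mean.
Proof. by apply: nondecreasing_measurable => //; exact: ramp_mean_homo. Qed.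

Lemma tail_weight (y : R) :
  exists q, has_mean P (fun w => expR (nu * xi w) * (y < xi w)%R%:R) q.
Proof.
apply: has_mean_dominated tilt1.
  apply: measurable_funM; first exact: measurable_tilt.
  exact: measurable_gt_indicator.
move=> w; rewrite normrM normr_nat ger0_norm ?expR_ge0//.
by case: (_ < _); rewrite ?mulr1// mulr0 expR_ge0.
Qed.

Lemma ramp_mean_step (x y q : R) : 0 <= y ->
  has_mean P (fun w => expR (nu * xi w) * (y + K < xi w)%R%:R) q ->
  ramp_mean (y - x) <= ramp_mean y - Num.min x K * q.
Proof.
move=> y0 hq.
have := has_meanB (ramp_weightP y) (has_meanZ (Num.min x K) hq).
move=> H; apply: (has_mean_le (ramp_weightP _) H) => w.
rewrite /ramp_weight; have [Kx|xK] := ltP K (xi w); last first.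
  rewrite !mulr0 !mul0r sub0r ltNge (_ : xi w <= y + K) ?mulr0 ?oppr0//.
  by rewrite (le_trans xK)// lerDr.
rewrite !mulr1 mulrCA -mulrBr ler_wpM2l ?expR_ge0//; exact: ramp_step.
Qed.

(** Lower bound, under the tilted law, for the probability that a level at
distance [y] is passed within [j] steps with overshoot at most [K]: the two
subtracted terms bound the probabilities of an overshoot larger than [K] and of
no passage. *)
Definition lyapunov (j : nat) (y : R) : R :=
  1 - ramp_mean y / a - expR (theta * y) * rho ^+ j.

(** The corresponding bound for the original law, whose density with respect to
the tilted one is at least [expR (- (nu * (y + K)))] at a passage with overshoot
at most [K].  Negative [y] means that the level is already passed. *)
Definition passage_bound (j : nat) (y : R) : R :=
  if y < 0 then 1 else Num.max 0 (expR (- (nu * (y + K))) * lyapunov j y).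

Lemma rho_ge0 : 0 <= rho.
Proof. by apply: (has_mean_le (has_mean_cst P 0) exp_mean) => w; exact: expR_ge0. Qed.

Lemma lyapunov_le1 j y : lyapunov j y <= 1.
Proof.
rewrite /lyapunov -addrA gerDl -opprD oppr_le0 addr_ge0//.
  by rewrite divr_ge0 ?ramp_mean_ge0// ltW.
by rewrite mulr_ge0 ?expR_ge0// exprn_ge0// rho_ge0.
Qed.

Lemma passage_bound_ge0 j y : 0 <= passage_bound j y.
Proof. by rewrite /passage_bound; case: ifP => // _; rewrite le_max lexx. Qed.

Lemma passage_bound_le1 j y : passage_bound j y <= 1.
Proof.
rewrite /passage_bound; case: ltP => // y0; rewrite ge_max ler01/=.
have [l0|l0] := leP 0 (lyapunov j y); last first.
  apply: (@le_trans _ _ 0); last exact: ler01.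
  by rewrite pmulr_rle0 ?expR_gt0// ltW.
rewrite -[leRHS]mulr1 ler_pM ?expR_ge0 ?lyapunov_le1//.
by rewrite -expR0 ler_expR oppr_le0 mulr_ge0 ?addr_ge0// ltW.
Qed.

Lemma measurable_passage_bound j : measurable_fun setT (passage_bound j).
Proof.
have me (c b : R) : measurable_fun setT (fun y : R => expR (c * (y + b))).
  apply: measurableT_comp => //; apply: measurable_funM => //.
  exact: measurable_funD.
apply: measurable_fun_ifT => //.
  exact: measurable_fun_ltr.
apply: measurable_maxr => //; apply: measurable_funM.
  have := me (- nu) K; congr measurable_fun; apply/funext => y.
  by rewrite mulNr.
apply: measurable_funB.
  apply: measurable_funB => //; apply: measurable_funM => //.
  exact: measurable_ramp_mean.
apply: measurable_funM => //.
have := me theta 0; congr measurable_fun; apply/funext => y.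
by rewrite addr0.
Qed.

(** [passage_bound] is a subsolution of the recursion of the passage
probabilities.  After tilting, the gain [q] from the decrease of [ramp_mean]
cancels the loss from the steps that overshoot by more than [K]. *)
Lemma passage_bound_step j (y v : R) : 0 <= y ->
  has_mean P (fun w => passage_bound j (y - xi w)) v ->
  passage_bound j.+1 y <= v.
Proof.
move=> y0 hv; have [q hq] := tail_weight (y + K).
have v0 : 0 <= v.
  by apply: (has_mean_le (has_mean_cst P 0) hv) => w; exact: passage_bound_ge0.
rewrite /passage_bound ltNge y0/= ge_max v0/=.
have H1 := has_meanZ (ramp_mean y / a) tilt1.
have H2 := has_meanZ (q / a) truncated_mean.
have H3 := has_meanZ (expR (theta * y) * rho ^+ j) exp_mean.
have H := has_meanZ (expR (- (nu * (y + K))))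
  (has_meanB (has_meanD (has_meanB (has_meanB tilt1 hq) H1) H2) H3).
apply: (@le_trans _ _ (expR (- (nu * (y + K))) *
   (1 - q - ramp_mean y / a * 1 + q / a * a - expR (theta * y) * rho ^+ j * rho))).
  rewrite ler_wpM2l ?expR_ge0// /lyapunov exprSr mulr1 mulfVK ?gt_eqF//.
  lra.
apply: (has_mean_le H hv) => w.
set x := xi w.
have -> : expR ((nu - theta) * x) = expR (nu * x) * expR (- (theta * x)).
  by rewrite -expRD; congr expR; ring.
set E := expR (nu * x).
(* [b] is a lower bound of [lyapunov j (y - x)] for [x <= y + K], and it is
   nonpositive for larger [x]. *)
set b := (1 - (y + K < x)%R%:R - (ramp_mean y - Num.min x K * q) / a
    - expR (theta * (y - x)) * rho ^+ j).
have -> : E - E * (y + K < x)%R%:R - ramp_mean y / a * E +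
    q / a * (Num.min x K * E) -
    expR (theta * y) * rho ^+ j * (E * expR (- (theta * x)))
    = E * b.
  rewrite /b (_ : theta * (y - x) = theta * y + - (theta * x)); last by ring.
  rewrite expRD; ring.
have st := ramp_mean_step x y0 hq.
rewrite mulrA -expRD.
have -> : - (nu * (y + K)) + nu * x = - (nu * (y - x + K)) by ring.
have b_le : b <= 1 - (y + K < x)%R%:R - ramp_mean (y - x) / a
    - expR (theta * (y - x)) * rho ^+ j.
  by rewrite lerD2r lerD2l lerN2 ler_pM2r// invr_gt0.
have [ltx|lex] := ltP (y + K) x.
  apply: le_trans (passage_bound_ge0 _ _).
  rewrite pmulr_rle0 ?expR_gt0//; apply: le_trans b_le _.
  rewrite ltx subrr sub0r -opprD oppr_le0 addr_ge0//.
    by rewrite divr_ge0 ?ramp_mean_ge0// ltW.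
  by rewrite mulr_ge0 ?expR_ge0// exprn_ge0// rho_ge0.
rewrite ltNge lex/= subr0 -/(lyapunov j (y - x)) in b_le.
rewrite /passage_bound; case: ltP => yx; last first.
  by rewrite le_max ler_wpM2l ?expR_ge0 ?orbT.
have [b0|b0] := leP 0 b; last first.
  by apply: (@le_trans _ _ 0); rewrite ?ler01// pmulr_rle0 ?expR_gt0// ltW.
rewrite -[leRHS]mulr1 ler_pM ?expR_ge0//; last exact: le_trans b_le (lyapunov_le1 j _).
rewrite -expR0 ler_expR oppr_le0 mulr_ge0//; first exact: ltW.
by rewrite addrAC subr_ge0.
Qed.

(** In zero steps nothing but an already passed level is passed: the last term of
[lyapunov 0] is at least [1]. *)
Lemma passage_bound0 y : 0 <= theta -> passage_bound 0 y <= (y < 0)%R%:R.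
Proof.
move=> t0; rewrite /passage_bound; case: ltP => // y0.
rewrite ge_max lexx/= pmulr_rle0 ?expR_gt0// /lyapunov expr0 mulr1.
rewrite subr_le0 (@le_trans _ _ 1)//.
  by rewrite gerBl divr_ge0 ?ramp_mean_ge0// ltW.
by rewrite -expR0 ler_expR mulr_ge0.
Qed.

End OvershootLyapunov.

(** * Deviations of a tilted random walk *)

Section WalkEstimates.
Context d (T : measurableType d) (R : realType) (P : probability T R).
Variable S : nat -> T -> R.
Hypothesis hS : random_walk P S.
Variable nu : R.
Hypothesis nu_gt0 : 0 < nu.
Hypothesis cramer : (\int[P]_w (expR (nu * S 1%N w))%:E = 1)%E.

Let tilt_step : has_mean P (fun w => expR (nu * S 1%N w)) 1.
Proof.
apply: has_mean_ge0_integral => //.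
by apply/measurable_EFinP; exact: (measurable_expR_walk hS).
Qed.

Lemma has_mean_tilt n : has_mean P (fun w => expR (nu * S n w)) 1.
Proof.
apply: has_mean_ge0_integral => //.
  by apply/measurable_EFinP; exact: (measurable_expR_walk hS).
by rewrite exp_moment_walk// cramer -EFin_expe expr1n.
Qed.

Lemma measurable_walk_le (c : R) n : measurable [set w | S n w <= c].
Proof.
rewrite (_ : [set w | _] = ~` [set w | c < S n w]).
  by apply: measurableC; exact: (measurable_walk_gt hS).
by apply/seteqP; split=> w /=; rewrite leNgt => /negP.
Qed.

Lemma measurable_walk_ge (c : R) n : measurable [set w | c <= S n w].
Proof.
have -> : [set w | c <= S n w] = S n @^-1` `[c, +oo[.
  by apply/seteqP; split=> w /=; rewrite in_itv/= andbT.
by rewrite -[X in measurable X]setTI; apply: (walk_measurable hS).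
Qed.

Lemma past_passedI u k : past S k (setT `&` first_passage S u k).
Proof. by rewrite setTI; exact: (past_first_passage hS). Qed.

Lemma measurable_passed u N : measurable (passed S u N).
Proof. by apply: (past_measurable hS); exact: (past_passed hS). Qed.

(** Ottaviani's inequality under the tilted law.  Passing [b] and ending below
[b - ln 2 / nu] has tilted weight at most [expR (nu * b) / 2] times the
probability of passing [b], hence at most half of the tilted weight of passing
[b]. *)
Lemma passed_le_end (b : R) N :
  (\int[P]_(w in passed S b N) (expR (nu * S N w))%:E <=
   2%:E * \int[P]_(w in [set w | (b - ln 2 / nu <= S N w)%R])
     (expR (nu * S N w))%:E)%E.
Proof.
set C := ln 2 / nu; set B := passed S b N; set E := [set w | _].
have mB : measurable B by exact: measurable_passed.
have mE : measurable E by exact: measurable_walk_ge.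
have [q _ qE] := has_mean_indic mB (has_mean_tilt N).
have [e _ eE] := has_mean_indic mE (has_mean_tilt N).
have mBE : measurable (B `\` E) by exact: measurableD.
have : ((expR (nu * b))%:E * P B <= q%:E)%E.
  have := passed_change_of_measure hS nu_gt0 cramer (A := setT) (u := b)
    (fun k _ => @past_passedI b k) (leqnn N).
  by rewrite setTI qE.
have PBE : P B = (fine (P B))%:E by rewrite fineK// fin_num_measure.
rewrite PBE -EFinM lee_fin => H1.
have : (q%:E <= e%:E + (expR (nu * (b - C)) * fine (P B))%:E)%E.
  rewrite -qE -eE.
  apply: (@le_trans _ _ (\int[P]_(w in E `|` (B `\` E)) (expR (nu * S N w))%:E)%E).
    apply: ge0_subset_integral => //.
    - exact: measurableU.
    - exact: (measurable_expR_walk hS).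
    - by move=> w Bw; have [Ew|Ew] := pselect (E w); [left|right; split].
  rewrite ge0_integral_setU//; last 2 first.
  - exact: (measurable_expR_walk hS).
  - by rewrite disj_set2E; apply/eqP/seteqP; split => // w [? []].
  apply: leeD => //.
  apply: (@le_trans _ _ (\int[P]_(w in B `\` E) (expR (nu * (b - C)))%:E)%E).
    apply: ge0_le_integral => //.
    - exact: (measurable_expR_walk hS).
    - move=> w [_ /= /negP]; rewrite -ltNge => lt.
      by rewrite lee_fin ler_expR ler_pM2l// ltW.
  rewrite integral_cst// EFinM -PBE; apply: lee_wpmul2l.
    by rewrite lee_fin expR_ge0.
  apply: le_measure; rewrite ?inE//; exact: subDsetl.
rewrite qE eE -EFinD -EFinM !lee_fin => H2.
have : expR (nu * (b - C)) = expR (nu * b) / 2.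
  rewrite mulrBr expRD expRN /C mulrCA divff ?gt_eqF// mulr1 lnK//.
  by rewrite posrE.
move=> H3; rewrite H3 in H2.
lra.
Qed.

(** Chernoff's bound: on [S n <= c] the weight [expR (nu * S n)] is at most
[expR (theta * c) * expR ((nu - theta) * S n)]. *)
Lemma lower_deviation (theta rho c : R) n : 0 <= theta ->
  has_mean P (fun w => expR ((nu - theta) * S 1%N w)) rho ->
  (\int[P]_(w in [set w | (S n w <= c)%R]) (expR (nu * S n w))%:E <=
   (expR (theta * c) * rho ^+ n)%:E)%E.
Proof.
move=> t0 [_ hrho]; set E := [set w | _].
have mE : measurable E by exact: measurable_walk_le.
have -> : ((expR (theta * c) * rho ^+ n)%:E =
    \int[P]_w (expR (theta * c) * expR ((nu - theta) * S n w))%:E)%E.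
  under eq_integral do rewrite EFinM.
  rewrite ge0_integralZl//; last exact: (measurable_expR_walk hS).
  by rewrite exp_moment_walk// hrho -EFin_expe -EFinM.
have mf A : measurable_fun A
    (fun w => (expR (theta * c) * expR ((nu - theta) * S n w))%:E).
  apply: measurable_funTS; apply/measurable_EFinP; apply: measurable_funM => //.
  by apply/measurable_EFinP; exact: (measurable_expR_walk hS).
apply: (@le_trans _ _
  (\int[P]_(w in E) (expR (theta * c) * expR ((nu - theta) * S n w))%:E)%E).
  apply: ge0_le_integral => //; first exact: (measurable_expR_walk hS).
  move=> w /= Sc; rewrite lee_fin -expRD ler_expR.
  have := ler_wpM2l t0 Sc; lra.
exact: ge0_subset_integral.
Qed.

Section Mean.
Variable mu : R.
Hypothesis tilt_mean :
  has_mean P (fun w => S 1%N w * expR (nu * S 1%N w)) mu.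

Lemma tilted_value_ge0 (y : R) : 0 <= y * expR (nu * y) + nu^-1.
Proof.
have H := expR_ge1Dx (- (nu * y)).
have e0 := expR_gt0 (nu * y).
have e1 : expR (- (nu * y)) * expR (nu * y) = 1 by rewrite -expRD addNr expR0.
rewrite -(pmulr_rge0 _ nu_gt0) mulrDr divff ?gt_eqF//.
nra.
Qed.

(** The tilted mean of [S n] is [n * mu].  Adding the constant [nu^-1] makes the
integrand nonnegative, so Tonelli's theorem suffices for the induction. *)
Lemma mean_walk n :
  has_mean P (fun w => S n w * expR (nu * S n w) + nu^-1) (n%:R * mu + nu^-1).
Proof.
elim: n => [|n IHn].
  rewrite mul0r add0r (_ : (fun w => _) = fun=> nu^-1); last first.
    by apply/funext => w; rewrite (walk_start hS) mul0r add0r.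
  exact: has_mean_cst.
have mk : measurable_fun setT (fun y : R => y * expR (nu * y) + nu^-1).
  apply: measurable_funD => //; apply: measurable_funM => //.
  by apply: measurableT_comp => //; exact: measurable_funM.
apply: has_mean_ge0_integral.
- by move=> w; exact: tilted_value_ge0.
- by apply: (measurableT_comp mk); exact: (walk_measurable hS).
pose f (x : R * R) : \bar R :=
  ((x.1 + x.2) * expR (nu * (x.1 + x.2)) + nu^-1)%:E.
have mf : measurable_fun [set: R * R] f.
  apply/measurable_EFinP; apply: (measurableT_comp mk).
  exact: measurable_funD.
have f0 x : (0 <= f x)%E by rewrite lee_fin tilted_value_ge0.
have := past_tonelli hS (@past_setT _ _ _ S n) mf f0; rewrite /f /=.
under eq_integral do rewrite (addrC (S n _) (_ - _)) subrK.
move=> ->.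
have inner w : (\int[P]_w' ((S n w + S 1%N w') * expR (nu * (S n w + S 1%N w'))
    + nu^-1)%:E = (S n w * expR (nu * S n w) + nu^-1 + mu * expR (nu * S n w))%:E)%E.
  have := has_meanD (has_meanZ (expR (nu * S n w))
    (has_meanD (has_meanZ (S n w) tilt_step) tilt_mean)) (has_mean_cst P nu^-1).
  move=> [_ H]; rewrite -(_ : expR (nu * S n w) * (S n w * 1 + mu) + nu^-1 =
    S n w * expR (nu * S n w) + nu^-1 + mu * expR (nu * S n w)); last by ring.
  rewrite -H; apply: eq_integral => w' _; congr EFin.
  by rewrite mulrDr expRD; ring.
under eq_integral do rewrite inner.
have [_ ->] := has_meanD IHn (has_meanZ mu (has_mean_tilt n)).
by congr EFin; rewrite -natr1; ring.
Qed.

(** The tilted law need not have exponential moments to the right, so the law of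
large numbers from above is deduced from the one below: since the mean is
[n * mu] and [S n] is rarely below [a' * n] with [a'] close to [mu], it cannot
exceed [a * n] with a probability that stays away from [0]. *)
Lemma upper_deviation (a C eps : R) : 0 < mu -> mu < a -> 0 < eps ->
  exists N, forall n, (N <= n)%N ->
  (\int[P]_(w in [set w | (a * n%:R - C <= S n w)%R])
     (expR (nu * S n w))%:E <= eps%:E)%E.
Proof.
move=> mu0 mua eps0.
pose kappa := (a - mu) / 2.
have k0 : 0 < kappa by rewrite divr_gt0// subr_gt0.
have [a' [a'0 a'mu a'k]] : exists a' : R, [/\ 0 < a', a' < mu &
    mu - a' <= kappa * eps / 3].
  exists (Num.max (mu / 2) (mu - kappa * eps / 3)); split.
  - by rewrite lt_max divr_gt0.
  - rewrite gt_max; apply/andP; split; last first.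
      by rewrite gtrBl divr_gt0// mulr_gt0.
    by rewrite ltr_pdivrMr// ltr_pMr// ltr1n.
  - by rewrite lerBlDl -lerBlDr le_max lexx orbT.
have [theta [rho [/andP[th0 _] hrho rate]]] :=
  chernoff_rate (walk_measurable hS 1) nu_gt0 tilt_step tilt_mean a'mu.
have rho0 : 0 <= rho.
  by apply: (has_mean_le (has_mean_cst P 0) hrho) => w; exact: expR_ge0.
set x := expR (theta * a') * rho in rate.
have x0 : 0 <= x by rewrite mulr_ge0 ?expR_ge0.
have x1 : `|x| < 1 by rewrite ger0_norm.
have near1 : \forall n \near \oo, a' * x ^+ n < kappa * eps / 3.
  have : a' * x ^+ n @[n --> \oo] --> a' * 0.
    by apply: cvgMr; exact: cvg_expr.
  rewrite mulr0 => /cvgr_lt; apply.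
  by rewrite divr_gt0// mulr_gt0.
have near2 : \forall n \near \oo, 3 / (nu * kappa * eps) <= n%:R :> R.
  exact: nbhs_infty_ger.
have near3 : \forall n \near \oo, C / kappa <= n%:R :> R by exact: nbhs_infty_ger.
have near4 : \forall n \near \oo, (0 < n)%N by exact: nbhs_infty_gt.
have [N _ HN] := filterI (filterI near1 near2) (filterI near3 near4).
exists N => n /HN[[/= n1 n2] [n3 n4]].
set E := [set w | _]; set D := [set w | (S n w <= a' * n%:R)%R].
have mE : measurable E by exact: measurable_walk_ge.
have mD : measurable D by exact: measurable_walk_le.
have [q hq qE] := has_mean_indic mE (has_mean_tilt n).
have [p hp pE] := has_mean_indic mD (has_mean_tilt n).
have pub : p <= x ^+ n.
  have := lower_deviation (a' * n%:R) n (ltW th0) hrho.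
  rewrite -/D pE lee_fin /x exprMn mulrA expRM_natr//.
rewrite qE lee_fin.
have nR0 : 0 < n%:R :> R by rewrite ltr0n.
have n2' : 1 / nu <= kappa * eps / 3 * n%:R.
  have : 0 < nu * kappa * eps by rewrite mulr_gt0// mulr_gt0.
  move=> h; rewrite ler_pdivrMr// in n2.
  rewrite ler_pdivrMr//; lra.
have n3' : C <= kappa * n%:R by rewrite mulrC -ler_pdivrMr.
have gap : kappa * n%:R <= a * n%:R - C - a' * n%:R.
  rewrite /kappa in n3' *; nra.
have H := has_meanB (has_meanD (has_meanZ (a' * n%:R) (has_mean_tilt n))
  (has_meanZ (a * n%:R - C - a' * n%:R) hq)) (has_meanZ (a' * n%:R) hp).
have : a' * n%:R * 1 + (a * n%:R - C - a' * n%:R) * q - a' * n%:R * p <=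
    n%:R * mu + nu^-1.
  apply: (has_mean_le H (mean_walk n)) => w.
  have t0 := tilted_value_ge0 (S n w).
  have e0 := expR_gt0 (nu * S n w).
  have nu'0 : 0 < nu^-1 by rewrite invr_gt0.
  have a'n : 0 < a' * n%:R by rewrite mulr_gt0.
  have kn : 0 < kappa * n%:R by rewrite mulr_gt0.
  rewrite !indicE.
  have inE_ : (w \in E) = (a * n%:R - C <= S n w).
    by apply/idP/idP; rewrite inE.
  have inD_ : (w \in D) = (S n w <= a' * n%:R) by apply/idP/idP; rewrite inE.
  rewrite inE_ inD_; have [Ew|Ew] := leP (a * n%:R - C) (S n w);
    have [Dw|Dw] := leP (S n w) (a' * n%:R); rewrite /=.
  - by exfalso; lra.
  - by have := ler_wpM2r (ltW e0) Ew; lra.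
  - by lra.
  - by have := ler_wpM2r (ltW e0) (ltW Dw); lra.
have q0 : 0 <= q.
  apply: (has_mean_le (has_mean_cst P 0) hq) => w.
  by rewrite mulr_ge0// expR_ge0.
move=> Hle.
have : kappa * n%:R * q <= kappa * eps * n%:R.
  have := ler_wpM2r q0 gap.
  have : a' * p <= kappa * eps / 3.
    by apply: le_trans (ltW n1); rewrite ler_pM2l.
  move=> /(ler_wpM2r (ltW nR0)) h1.
  move: (ler_wpM2r (ltW nR0) a'k) => h2 h3.
  lra.
rewrite mulrAC [leRHS]mulrAC => fin.
have kn := mulr_gt0 k0 nR0.
by rewrite -(ler_pM2l kn); lra.
Qed.

End Mean.

End WalkEstimates.

(** * The exponential lower bound for the passage probability *)

Section PassageLowerBound.
Context d (T : measurableType d) (R : realType) (P : probability T R).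
Variable S : nat -> T -> R.
Hypothesis hS : random_walk P S.
Variables (nu mu : R).
Hypotheses (nu_gt0 : 0 < nu) (mu_gt0 : 0 < mu).
Hypothesis tilt1 : has_mean P (fun w => expR (nu * S 1%N w)) 1.
Hypothesis tilt_mean :
  has_mean P (fun w => S 1%N w * expR (nu * S 1%N w)) mu.

Definition hit_between (u : R) (n j : nat) : set T :=
  [set w | exists2 k, (n <= k <= n + j)%N & u < S k w].

Lemma hit_between0 u n : hit_between u n 0 = [set w | u < S n w].
Proof.
apply/seteqP; split=> [w [k]|w uw]; last first.
  by exists n => //; rewrite leqnn addn0 leqnn.
by rewrite addn0 -eqn_leq => /eqP ->.
Qed.

Lemma hit_betweenS u n j :
  hit_between u n j.+1 = [set w | u < S n w] `|` hit_between u n.+1 j.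
Proof.
apply/seteqP; split=> [w [k /andP[nk kn] uw]|w [uw|[k /andP[nk kn] uw]]].
- move: nk; rewrite leq_eqVlt => /orP[/eqP ->|nk]; [by left|right].
  by exists k => //; rewrite nk addSnnS.
- by exists n => //; rewrite leqnn leq_addr.
- by exists k => //; rewrite ltnW//= -addSnnS.
Qed.

Lemma measurable_hit_between u n j : measurable (hit_between u n j).
Proof.
elim: j n => [|j IHj] n.
  by rewrite hit_between0; exact: (measurable_walk_gt hS).
by rewrite hit_betweenS; apply: measurableU => //; exact: (measurable_walk_gt hS).
Qed.

Section WithConstants.
Variables (K r a theta rho : R).
Hypotheses (K_gt0 : 0 < K) (a_gt0 : 0 < a) (theta_ge0 : 0 <= theta).
Hypothesis tail_mean : has_mean P
  (fun w => S 1%N w * expR (nu * S 1%N w) * (K < S 1%N w)%R%:R) r.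
Hypothesis truncated_mean :
  has_mean P (fun w => Num.min (S 1%N w) K * expR (nu * S 1%N w)) a.
Hypothesis exp_mean :
  has_mean P (fun w => expR ((nu - theta) * S 1%N w)) rho.

Let mS1 := walk_measurable hS 1%N.
Let Psi := passage_bound P (S 1%N) nu K a theta rho.

Let mPsi j : measurable_fun setT (Psi j).
Proof. exact: (measurable_passage_bound mS1 _ _ _ K_gt0 tail_mean). Qed.

Let Psi_ge0 j y : 0 <= Psi j y.
Proof. exact: passage_bound_ge0. Qed.

Let Psi_le1 j y : Psi j y <= 1.
Proof. exact: (passage_bound_le1 mS1 nu_gt0 K_gt0 a_gt0 tail_mean exp_mean). Qed.

(** Induction on the number of remaining steps: either the level is passed now, or
one more step is integrated out and [passage_bound_step] applies. *)
Lemma hit_lower_bound u j n A : past S n A ->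
  (\int[P]_(w in A) (Psi j (u - S n w))%:E <=
   P (A `&` hit_between u n j))%E.
Proof.
have mPu i k (B : set T) : measurable_fun B (fun w => (Psi i (u - S k w))%:E).
  apply: measurable_funTS; apply/measurable_EFinP.
  apply: (measurableT_comp (mPsi i)); apply: measurable_funB => //.
  exact: (walk_measurable hS).
elim: j n A => [|j IHj] n A pA; have mA := past_measurable hS pA.
  rewrite hit_between0 -(setIC _ A) -integral_indic//; last first.
    exact: (measurable_walk_gt hS).
  apply: ge0_le_integral => //.
  - by move=> w _; rewrite lee_fin.
  - apply: measurable_funTS; apply/measurable_EFinP; apply: measurable_indic.
    exact: (measurable_walk_gt hS).
  move=> w _; rewrite lee_fin indicE.
  have -> : (w \in [set w | u < S n w]) = (u - S n w < 0).
    by rewrite subr_lt0; apply/idP/idP; rewrite inE.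
  exact: (passage_bound0 mS1 _ K_gt0 a_gt0 tail_mean).
pose H := [set w | u < S n w].
have pH : past S n H by exact: (past_walk_gt hS).
have mH := past_measurable hS pH.
have pA2 : past S n (A `\` H) by apply: past_setI => //; exact: past_setC.
have mA2 := past_measurable hS pA2.
have mA1 : measurable (A `&` H) by exact: measurableI.
rewrite -[X in (\int[P]_(w in X) _)%E](setUIDK A H).
rewrite ge0_integral_setU//; last 2 first.
- by move=> w _; rewrite lee_fin.
- by rewrite disj_set2E; apply/eqP/seteqP; split => // w [[_ ?] []].
apply: (@le_trans _ _ (P (A `&` H) + P ((A `\` H) `&` hit_between u n.+1 j))%E).
  apply: leeD.
    apply: (@le_trans _ _ (\int[P]_(w in A `&` H) (cst 1 w))%E).
      apply: ge0_le_integral => //.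
      - by move=> w _; rewrite lee_fin.
      - by move=> w _; rewrite lee_fin.
    by rewrite integral_cst// mul1e.
  apply: le_trans (IHj n.+1 _ (past_mono (leqnSn n) pA2)).
  pose f (x : R * R) : \bar R := (Psi j (u - (x.1 + x.2)))%:E.
  have mf : measurable_fun [set: R * R] f.
    apply/measurable_EFinP; apply: (measurableT_comp (mPsi j)).
    by apply: measurable_funB => //; exact: measurable_funD.
  have f0 x : (0 <= f x)%E by rewrite lee_fin.
  have := past_tonelli hS pA2 mf f0; rewrite /f /=.
  under eq_integral do rewrite (addrC (S n _) (_ - _)) subrK.
  move=> ->.
  have inner w : exists2 v, has_mean P (fun w' => Psi j (u - (S n w + S 1%N w'))) v
    & (\int[P]_w' (Psi j (u - (S n w + S 1%N w')))%:E = v%:E)%E.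
    have [v hv] : exists v, has_mean P (fun w' => Psi j (u - (S n w + S 1%N w'))) v.
      apply: (has_mean_dominated _ _ (has_mean_cst P 1)).
        apply: (measurableT_comp (mPsi j)); apply: measurable_funB => //.
        by apply: measurable_funD.
      by move=> w'; rewrite ger0_norm.
    by exists v => //; exact: hv.2.
  pose F (s : R) := (\int[P]_w' (Psi j (u - (s + S 1%N w')))%:E)%E.
  have mF : measurable_fun [set: R] F.
    apply: (@measurable_fun_fubini_tonelli_F _ _ R T R P
      (fun x => (Psi j (u - (x.1 + S 1%N x.2)))%:E)).
    + apply/measurable_EFinP; apply: (measurableT_comp (mPsi j)).
      apply: measurable_funB => //; apply: measurable_funD => //.
      exact: (measurableT_comp mS1).
    + by move=> x; rewrite lee_fin.
  apply: ge0_le_integral => //.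
  - by move=> w _; rewrite lee_fin.
  - apply: measurable_funTS.
    exact: (measurableT_comp mF (walk_measurable hS n)).
  - move=> w [_ /= /negP]; rewrite -leNgt => uw.
    have [v hv ->] := inner w; rewrite lee_fin.
    apply: (passage_bound_step mS1 nu_gt0 tilt1 K_gt0 a_gt0 tail_mean
      truncated_mean exp_mean).
      by rewrite subr_ge0.
    move: hv; congr has_mean; apply/funext => w'; congr (Psi j _); ring.
rewrite -measureU//; last 2 first.
- by apply: measurableI => //; exact: measurable_hit_between.
- by apply/seteqP; split => // w [[_ ?] [[]]].
apply: le_measure; rewrite ?inE.
- by apply: measurableU => //; apply: measurableI => //; exact: measurable_hit_between.
- by apply: measurableI => //; exact: measurable_hit_between.
by rewrite hit_betweenS => w [[Aw Hw]|[[Aw _] ?]]; split=> //; [left|right].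
Qed.

Lemma passed_lower_bound u j : 0 <= u ->
  ((expR (- (nu * (u + K))) * (1 - r / a - expR (theta * u) * rho ^+ j))%:E <=
   P (passed S u j))%E.
Proof.
move=> u0; have := @hit_lower_bound u j 0%N setT (@past_setT _ _ _ S 0%N).
rewrite setTI; have -> : hit_between u 0 j = passed S u j.
  by apply/seteqP; split=> w [k /= kj uw]; exists k.
apply: le_trans; under eq_integral do rewrite (walk_start hS) subr0.
have [_ ->] := has_mean_cst P (Psi j u).
rewrite lee_fin /Psi /passage_bound ltNge u0/= le_max; apply/orP; right.
rewrite ler_wpM2l ?expR_ge0// /lyapunov lerD2r lerD2l lerN2.
rewrite ler_pM2r ?invr_gt0//.
exact: (ramp_mean_le mS1 K_gt0 tail_mean).
Qed.

End WithConstants.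

(** Finiteness of the tilted mean enters here: the part [r] of it that comes from
the jumps larger than [K] tends to [0], so [K] can be chosen such that an overshoot larger
than [K] has tilted probability at most [1 / 4], uniformly in the level. *)
Lemma passage_exponential_lower_bound :
  exists2 c : R, 0 < c & forall u, 0 <= u ->
    exists N, ((c * expR (- (nu * u)))%:E <= P (passed S u N))%E.
Proof.
have mS1 := walk_measurable hS 1%N.
have [theta [rho [/andP[th0 _] hrho rate]]] :=
  chernoff_rate mS1 nu_gt0 tilt1 tilt_mean mu_gt0.
have mu5 : 0 < mu / 5 by rewrite divr_gt0.
have [K [r [K0 hr r_lt]]] := upper_tail_mean_small mS1 tilt_mean mu5.
have [m1 hm1] := has_mean_norm tilt_mean.
have [a ha] : exists a,
    has_mean P (fun w => Num.min (S 1%N w) K * expR (nu * S 1%N w)) a.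
  apply: (has_mean_dominated _ _ (has_meanD hm1 (has_meanZ K tilt1))).
    apply: measurable_funM; last exact: measurable_tilt.
    exact: measurable_minr.
  move=> w; rewrite !normrM !(ger0_norm (expR_ge0 _)) -mulrDl.
  apply: ler_wpM2r; first exact: expR_ge0.
  have [_|/ltW KS] := leP (S 1%N w) K; first by rewrite lerDl ltW.
  by rewrite gtr0_norm// lerDr.
have ar : mu - r <= a.
  apply: (has_mean_le (has_meanB tilt_mean hr) ha) => w.
  have e0 := expR_gt0 (nu * S 1%N w).
  have [Sle|Sgt] := leP (S 1%N w) K; first by rewrite mulr0 subr0.
  by rewrite mulr1 subrr mulr_ge0// ltW.
have a0 : 0 < a by lra.
have rho0 : 0 <= rho.
  by apply: (has_mean_le (has_mean_cst P 0) hrho) => w; exact: expR_ge0.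
have rho1 : `|rho| < 1 by move: rate; rewrite mulr0 expR0 mul1r ger0_norm.
exists (expR (- (nu * K)) / 2); first by rewrite divr_gt0// expR_gt0.
move=> u u0.
have : expR (theta * u) * rho ^+ j @[j --> \oo] --> expR (theta * u) * 0.
  by apply: cvgMr; exact: cvg_expr.
rewrite mulr0 => /cvgr_lt/(_ (1 / 4)).
case=> [|N _ /(_ N (leqnn N)) /= hN]; first by rewrite divr_gt0.
exists N; apply: le_trans (passed_lower_bound K0 a0 (ltW th0) hr ha hrho N u0).
rewrite lee_fin.
have -> : expR (- (nu * (u + K))) = expR (- (nu * K)) * expR (- (nu * u)).
  by rewrite -expRD; congr expR; ring.
rewrite mulrAC; apply: ler_wpM2l; first by rewrite mulr_ge0// expR_ge0.
have : r / a <= 1 / 4 by rewrite ler_pdivrMr//; lra.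
lra.
Qed.

End PassageLowerBound.

(** * Upper bounds for passages of a random walk *)

Section WalkPassageBounds.
Context d (T : measurableType d) (R : realType) (P : probability T R).
Variable S : nat -> T -> R.
Hypothesis hS : random_walk P S.
Variable nu : R.
Hypothesis nu_gt0 : 0 < nu.
Hypothesis cramer : (\int[P]_w (expR (nu * S 1%N w))%:E = 1)%E.

Lemma past_set0 k : past S k set0.
Proof. exact: (@measurable0 _ (g_sigma_algebraType (past_rectangle S k))). Qed.

Lemma first_passage_sub_passed (b u : R) k n : b <= u -> (k <= n)%N ->
  first_passage S u k `<=` passed S b n.
Proof. by move=> bu kn w [/= uw _]; exists k => //; exact: le_lt_trans uw. Qed.

Lemma le_expR_inv (x : R) (p q : \bar R) :
  ((expR x)%:E * p <= q -> p <= (expR (- x))%:E * q)%E.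
Proof.
move=> H; have : ((expR (- x))%:E * ((expR x)%:E * p) <= (expR (- x))%:E * q)%E.
  by apply: lee_wpmul2l => //; rewrite lee_fin expR_ge0.
by rewrite muleA -EFinM -expRD addNr expR0 mul1e.
Qed.

Lemma walk_passage_le u N : (P (passed S u N) <= (expR (- (nu * u)))%:E)%E.
Proof.
rewrite -[leRHS]mule1; apply: le_expR_inv.
have := passed_change_of_measure hS nu_gt0 cramer
  (fun k _ => @past_passedI _ _ _ _ _ hS u k) (leqnn N).
rewrite setTI => /le_trans; apply; apply: tilt_le1 => //.
exact: (measurable_passed hS).
Qed.

(** A passage after time [n] by a path that is below [c] at time [n]: by the change
of measure its cost, relative to [expR (- (nu * u))], is the tilted weight of
[S n <= c]. *)
Lemma walk_late_passage (u c : R) n N :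
  (P (([set w | (S n w <= c)%R] `\` passed S u n) `&` passed S u N) <=
   (expR (- (nu * u)))%:E *
   \int[P]_(w in [set w | (S n w <= c)%R]) (expR (nu * S n w))%:E)%E.
Proof.
apply: le_expR_inv; set A := [set w | _] `\` _.
have pA : past S n A.
  apply: past_setI; last by apply: past_setC; exact: (past_passed hS).
  rewrite (_ : [set w | _] = S n @^-1` `]-oo, c]); last first.
    by apply/seteqP; split=> w /=; rewrite in_itv.
  by apply: (past_preimage hS) => //; exact: measurable_itv.
have mA := past_measurable hS pA.
have mP := measurable_passed hS u N.
have pAk k : (k <= N)%N -> past S k (A `&` first_passage S u k).
  move=> _; have [kn|nk] := leqP k n; last first.
    apply: past_setI; last exact: (past_first_passage hS).
    exact: past_mono (ltnW nk) pA.
  rewrite (_ : _ `&` _ = set0); first exact: past_set0.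
  apply/seteqP; split=> // w [[_ nP] /(first_passage_sub_passed (lexx u) kn)].
  exact: nP.
apply: le_trans (passed_change_of_measure hS nu_gt0 cramer pAk (leq_maxl N n)) _.
apply: (@le_trans _ _ (\int[P]_(w in A) (expR (nu * S (maxn N n) w))%:E)%E).
  apply: ge0_subset_integral => //; first exact: measurableI.
  exact: (measurable_expR_walk hS).
rewrite (tilt_martingale hS cramer (leq_maxr N n) pA).
apply: ge0_subset_integral => //; first exact: (measurable_walk_le hS).
  exact: (measurable_expR_walk hS).
exact: subDsetl.
Qed.

(** For a path that exceeds [b] before time [n] and [u] at any time, the relative
cost is the tilted weight of passing [b] before [n].  The first passage above
[u] may fall on either side of [n]: up to [n], it is also a passage above [b]. *)
Lemma walk_early_passage b u n N : b <= u ->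
  (P (passed S b n `&` passed S u N) <= (expR (- (nu * u)))%:E *
   (2%:E * \int[P]_(w in [set w | (b - ln 2 / nu <= S n w)%R])
      (expR (nu * S n w))%:E))%E.
Proof.
move=> bu; apply: le_expR_inv; set A := passed S b n.
have pA : past S n A by exact: (past_passed hS).
have mA := past_measurable hS pA.
have mP := measurable_passed hS u N.
have pAk k : (k <= N)%N -> past S k (A `&` first_passage S u k).
  move=> _; have [kn|nk] := leqP k n; last first.
    apply: past_setI; last exact: (past_first_passage hS).
    exact: past_mono (ltnW nk) pA.
  rewrite setIidr; first exact: (past_first_passage hS).
  exact: first_passage_sub_passed.
apply: le_trans (passed_change_of_measure hS nu_gt0 cramer pAk (leq_maxl N n)) _.
apply: le_trans (passed_le_end hS nu_gt0 cramer b n).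
rewrite -(tilt_martingale hS cramer (leq_maxr N n) pA).
apply: ge0_subset_integral => //; first exact: measurableI.
exact: (measurable_expR_walk hS).
Qed.

End WalkPassageBounds.

(** * From dyadic skeletons to continuous time *)

Lemma expe_eq1 (R : realType) (x : \bar R) n :
  (0 <= x -> x ^+ n.+1 = 1 -> x = 1)%E.
Proof.
case: x => [r| |] //; last first.
  have -> : (+oo ^+ n.+1 = +oo :> \bar R)%E; last by [].
  by elim: n => [|n IHn]; rewrite ?expe1// expeS IHn mulyy.
rewrite lee_fin => r0; rewrite -EFin_expe => -[] /eqP.
by rewrite pexpr_eq1// => /eqP ->.
Qed.

Section LevyGrid.
Context d (T : measurableType d) (R : realType) (P : probability T R).
Variable X : R -> T -> R.
Hypothesis hX : levy_process P X.

Definition grid (m n : nat) (w : T) : R := X (n%:R / 2 ^+ m) w.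

Let pow2_gt0 m : 0 < 2 ^+ m :> R. Proof. exact: exprn_gt0. Qed.

Lemma grid_walk m : random_walk P (grid m).
Proof.
have t0 n : 0 <= n%:R / 2 ^+ m :> R by rewrite divr_ge0// ltW.
split.
- by move=> n; exact: (levy_measurable hX).
- by move=> w; rewrite /grid mul0r (levy_start hX).
- move=> n B mB.
  apply: (levy_independent hX n (t := fun i => i%:R / 2 ^+ m)) => //.
  by move=> i; rewrite ler_pM2r ?invr_gt0// ler_nat.
- move=> n B mB; rewrite /grid.
  have := levy_stationary hX (t0 n) (t0 1%N) mB.
  by rewrite -mulrDl natr1.
Qed.

Lemma grid0 n w : grid 0 n w = X n%:R w.
Proof. by rewrite /grid expr0 divr1. Qed.

Lemma grid_nat m n w : grid m (n * 2 ^ m) w = X n%:R w.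
Proof. by rewrite /grid natrM natrX mulfK// gt_eqF. Qed.

(** Cramer's condition passes to every dyadic skeleton, because the exponential
moment at time [1] is a power of the one at time [1 / 2 ^ m]. *)
Lemma grid_exp_moment (a : R) m n :
  (\int[P]_w (expR (a * X 1 w))%:E = 1)%E ->
  (\int[P]_w (expR (a * grid m n w))%:E = 1)%E.
Proof.
move=> H; rewrite (exp_moment_walk (grid_walk m)).
rewrite (_ : (\int[P]_w (expR (a * grid m 1 w))%:E)%E = 1%E).
  by rewrite -EFin_expe expr1n.
apply: (@expe_eq1 _ _ (2 ^ m).-1).
  by apply: integral_ge0 => w _; rewrite lee_fin expR_ge0.
rewrite prednK ?expn_gt0// -(exp_moment_walk (grid_walk m)).
by under eq_integral do rewrite -[(2 ^ m)%N]mul1n grid_nat.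
Qed.

End LevyGrid.

(** By right-continuity an excess over [b] persists for a while after [r], long
enough to be seen at a dyadic time. *)
Lemma right_continuous_dyadic (R : realType) (f : R -> R) (r t b : R) :
  0 <= r -> r < t -> f s @[s --> r^'+] --> f r -> b < f r ->
  exists m k : nat, r < k%:R / 2 ^+ m < t /\ b < f (k%:R / 2 ^+ m).
Proof.
move=> r0 rt cf bf.
have /cvgr_gt/(_ b bf) := cf.
have : \forall s \near r^'+, s < t by exact: nbhs_right_lt.
move=> /[swap] H1 H2; have := filterI H1 H2.
rewrite near_simpl => -[e /= e0 He].
have [m hm] : exists m : nat, (2 ^+ m)^-1 < e.
  have : (2^-1 : R) ^+ n @[n --> \oo] --> 0.
    apply: cvg_expr; rewrite ger0_norm ?invr_ge0// invf_lt1// ltr1n//.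
  move=> /cvgr_lt/(_ e e0) [N _ /(_ N (leqnn N)) /= hN].
  by exists N; rewrite -exprVn.
have p0 : 0 < 2 ^+ m :> R by exact: exprn_gt0.
pose k := (Num.truncn (r * 2 ^+ m)).+1.
have rk : r < k%:R / 2 ^+ m.
  by rewrite ltr_pdivlMr// /k truncnS_gt.
have kr : k%:R / 2 ^+ m <= r + (2 ^+ m)^-1.
  rewrite ler_pdivrMr// mulrDl mulVf ?gt_eqF// /k -natr1 lerD2r.
  by rewrite truncn_le// mulr_ge0// ltW.
have [] : f (k%:R / 2 ^+ m) > b /\ k%:R / 2 ^+ m < t.
  apply: He => //=; rewrite distrC ger0_norm ?subr_ge0 ?ltW//.
  by rewrite ltrBlDl; apply: le_lt_trans kr _; rewrite ltrD2l.
by move=> ? ?; exists m, k; rewrite rk.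
Qed.

Section MeasureBigcup.
Context d (T : measurableType d) (R : realType) (P : probability T R).

Lemma measure_bigcup_nondecreasing_le (F : nat -> set T) (x : \bar R) :
  (forall m, measurable (F m)) -> nondecreasing_seq F ->
  (forall m, (P (F m) <= x)%E) -> (P (\bigcup_m F m) <= x)%E.
Proof.
move=> mF ndF Fx; have mU : measurable (\bigcup_m F m) by exact: bigcupT_measurable.
have cv := nondecreasing_cvg_mu (mu := P) mF mU ndF.
rewrite -(cvg_lim _ cv)//; apply: lime_le; first by apply/cvg_ex; eexists; exact: cv.
exact: nearW.
Qed.

Lemma has_mean0_ae (f : T -> R) m : has_mean P f m -> (forall w, 0 <= f w) ->
  m <= 0 -> {ae P, forall w, f w = 0}.
Proof.
move=> hf f0 m0; have m0' : m = 0.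
  apply/eqP; rewrite eq_le m0/=.
  exact: (has_mean_le (has_mean_cst P 0) hf).
have mf := has_mean_measurable hf.
have := ae_eq_integral_abs P measurableT (f := EFin \o f).
case; first exact/measurable_EFinP.
case=> [|N [mN PN HN] _].
  under eq_integral do rewrite /= ger0_norm//.
  by rewrite (hf.2) m0'.
exists N; split => // w /= Hw; apply: HN => /= H; apply: Hw.
by have := H Logic.I => -[].
Qed.

End MeasureBigcup.

Section ContinuousPassage.
Context d (T : measurableType d) (R : realType) (P : probability T R).
Variable X : R -> T -> R.
Hypothesis hX : levy_process P X.

Let pow2_gt0 m : 0 < 2 ^+ m :> R. Proof. exact: exprn_gt0. Qed.

Definition crossed (b : R) (n : nat) : set T :=
  [set w | exists2 r, 0 <= r <= n%:R & b < X r w].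

Lemma passageP u w : passage X u w <-> exists2 t, 0 <= t & u < X t w.
Proof.
rewrite /passage/= /passage_time; split.
  move=> /ereal_inf_lt[_ [t [t0 uX] <-] _].
  by exists t.
move=> [t t0 uX]; apply: le_lt_trans (ltry t).
by apply: ereal_inf_lbound; exists t.
Qed.

Lemma passed_grid_sub b m m' n n' : (m <= m')%N -> (n <= n')%N ->
  passed (grid X m) b (n * 2 ^ m) `<=` passed (grid X m') b (n' * 2 ^ m').
Proof.
move=> mm nn w [k kn bk]; exists (k * 2 ^ (m' - m))%N.
  rewrite -[in leqRHS](subnK mm) addnC expnD mulnA leq_mul2r.
  by rewrite (leq_trans kn) ?orbT// leq_mul2r nn orbT.
move: bk; rewrite /grid natrM natrX; congr (_ < X _ w).
have -> : 2 ^+ m' = 2 ^+ (m' - m) * 2 ^+ m :> R by rewrite -exprD subnK.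
by field; rewrite !gt_eqF.
Qed.

Lemma crossed_bigcup b n :
  crossed b n = \bigcup_m passed (grid X m) b (n * 2 ^ m).
Proof.
apply/seteqP; split=> [w [r /andP[r0 rn] bX]|w [m _ [k kn bX]]]; last first.
  exists (k%:R / 2 ^+ m) => //; apply/andP; split.
    by rewrite divr_ge0// ltW.
  by rewrite ler_pdivrMr// -natrX -natrM ler_nat.
move: rn; rewrite le_eqVlt => /orP[/eqP rn|rn].
  by exists 0%N => //; exists n; rewrite ?muln1// grid0 -rn.
have [m [k [/andP[_ kn] bk]]] :=
  right_continuous_dyadic r0 rn ((levy_cadlag hX w).1 r r0) bX.
exists m => //; exists k => //; rewrite -(ler_nat R) natrM natrX.
by rewrite -ler_pdivrMr// ltW.
Qed.

Lemma passage_bigcup u :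
  passage X u = \bigcup_m passed (grid X m) u (m * 2 ^ m).
Proof.
apply/seteqP; split=> [w /passageP[r r0 uX]|w [m _ [k kn uX]]]; last first.
  by apply/passageP; exists (k%:R / 2 ^+ m) => //; rewrite divr_ge0// ltW.
have [n rn] : exists n : nat, r <= n%:R.
  by exists (Num.truncn r).+1; rewrite ltW// truncnS_gt.
have : crossed u n w by exists r => //; rewrite r0.
rewrite crossed_bigcup => -[m _ uw]; exists (maxn m n) => //.
by apply: passed_grid_sub uw; rewrite ?leq_maxl ?leq_maxr.
Qed.

Lemma measurable_crossed b n : measurable (crossed b n).
Proof.
rewrite crossed_bigcup; apply: bigcupT_measurable => m.
exact: (measurable_passed (grid_walk hX m)).
Qed.

Lemma measurable_passage u : measurable (passage X u).
Proof.
rewrite passage_bigcup; apply: bigcupT_measurable => m.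
exact: (measurable_passed (grid_walk hX m)).
Qed.

Variable nu : R.
Hypothesis nu_gt0 : 0 < nu.
Hypothesis cramer : (\int[P]_w (expR (nu * X 1 w))%:E = 1)%E.

Let passage_nd u : nondecreasing_seq (fun m => passed (grid X m) u (m * 2 ^ m)).
Proof. by move=> m n mn; apply/subsetPset; exact: passed_grid_sub. Qed.

Let crossed_nd b n : nondecreasing_seq (fun m => passed (grid X m) b (n * 2 ^ m)).
Proof. by move=> m m' mm; apply/subsetPset; exact: passed_grid_sub. Qed.

Lemma passage_le u : (P (passage X u) <= (expR (- (nu * u)))%:E)%E.
Proof.
rewrite passage_bigcup; apply: measure_bigcup_nondecreasing_le => // m.
  exact: (measurable_passed (grid_walk hX m)).
apply: (walk_passage_le (grid_walk hX m)) => //.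
exact: grid_exp_moment.
Qed.

Lemma late_passage (u c : R) n :
  (P (([set w | (X n%:R w <= c)%R] `\` crossed u n) `&` passage X u) <=
   (expR (- (nu * u)))%:E *
   \int[P]_(w in [set w | (X n%:R w <= c)%R]) (expR (nu * X n%:R w))%:E)%E.
Proof.
rewrite passage_bigcup setI_bigcupr.
have mA : measurable ([set w | X n%:R w <= c] `\` crossed u n).
  apply: measurableD; last exact: measurable_crossed.
  have := measurable_walk_le (grid_walk hX 0) c n.
  by congr measurable; apply/seteqP; split=> w /=; rewrite grid0.
apply: measure_bigcup_nondecreasing_le.
- move=> m; apply: measurableI => //.
  exact: (measurable_passed (grid_walk hX m)).
- by move=> m m' mm; apply/subsetPset; apply: setIS; exact/subsetPset/passage_nd.
move=> m.
have := walk_late_passage (grid_walk hX m) nu_gt0 (grid_exp_moment hX m 1 cramer)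
  u c (n * 2 ^ m) (m * 2 ^ m).
under eq_integral do rewrite grid_nat.
rewrite (_ : [set w | grid X m (n * 2 ^ m) w <= c] = [set w | X n%:R w <= c]).
  apply: le_trans; apply: le_measure; rewrite ?inE.
  - by apply: measurableI => //; exact: (measurable_passed (grid_walk hX m)).
  - apply: measurableI; last exact: (measurable_passed (grid_walk hX m)).
    apply: measurableD; last exact: (measurable_passed (grid_walk hX m)).
    have := measurable_walk_le (grid_walk hX 0) c n.
    by congr measurable; apply/seteqP; split=> w /=; rewrite grid0.
  move=> w [[Xc nc] pw]; split=> //; split=> // cw; apply: nc.
  by rewrite crossed_bigcup; exists m.
by apply/seteqP; split=> w /=; rewrite grid_nat.
Qed.

Lemma early_passage (b u : R) n : b <= u ->
  (P (crossed b n `&` passage X u) <= (expR (- (nu * u)))%:E *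
   (2%:E * \int[P]_(w in [set w | (b - ln 2 / nu <= X n%:R w)%R])
      (expR (nu * X n%:R w))%:E))%E.
Proof.
move=> bu; rewrite passage_bigcup crossed_bigcup.
set F := fun m => passed (grid X m) b (n * 2 ^ m).
set G := fun m => passed (grid X m) u (m * 2 ^ m).
have -> : \bigcup_m F m `&` \bigcup_m G m = \bigcup_m (F m `&` G m).
  apply/seteqP; split=> [w [[m _ Fw] [m' _ Gw]]|w [m _ [Fw Gw]]]; last first.
    by split; exists m.
  exists (maxn m m') => //; split.
    exact: (subsetPset _ _ (crossed_nd b n (leq_maxl m m'))).
  exact: (subsetPset _ _ (passage_nd u (leq_maxr m m'))).
apply: measure_bigcup_nondecreasing_le.
- by move=> m; apply: measurableI; exact: (measurable_passed (grid_walk hX m)).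
- move=> m m' mm; apply/subsetPset; apply: setISS.
    exact/subsetPset/crossed_nd.
  exact/subsetPset/passage_nd.
move=> m.
have := walk_early_passage (grid_walk hX m) nu_gt0 (grid_exp_moment hX m 1 cramer)
  (n * 2 ^ m) (m * 2 ^ m) bu.
under eq_integral do rewrite grid_nat.
rewrite (_ : [set w | _ <= grid X m (n * 2 ^ m) w] =
  [set w | b - ln 2 / nu <= X n%:R w])//.
by apply/seteqP; split=> w /=; rewrite grid_nat.
Qed.

End ContinuousPassage.

(** * The tilted mean is positive *)

Section PositiveDrift.
Context d (T : measurableType d) (R : realType) (P : probability T R).
Variable X : R -> T -> R.
Hypothesis hX : levy_process P X.

Lemma levy_process_opp : levy_process P (fun t w => - X t w).
Proof.
have mopp (B : set (measurableTypeR R)) : measurable B ->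
    measurable ((fun x : measurableTypeR R => - x) @^-1` B).
  by move=> mB; rewrite -[X in measurable X]setTI; apply: (@oppr_measurable R).
have oppE s t w : - X t w - - X s w = - (X t w - X s w) by rewrite opprB opprK addrC.
split.
- move=> t t0; apply: measurableT_comp => //; exact: (levy_measurable hX).
- by move=> w; rewrite (levy_start hX) oppr0.
- move=> w; have [cr cl] := levy_cadlag hX w; split=> t t0.
    by apply: cvgN; exact: cr.
  by apply: is_cvgN; exact: cl.
- move=> n t B t0 tle mB.
  have := levy_independent hX n t0 tle (fun i => mopp _ (mB i)).
  set A := [set w | _] => H.
  rewrite (_ : [set w | _] = A); last first.
    by apply/seteqP; split=> w /= Hw i ilt; have := Hw i ilt; rewrite /= oppE.
  rewrite H; apply: eq_bigr => i _; congr (P _).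
  by apply/seteqP; split=> w /=; rewrite oppE.
- move=> s t B s0 t0 mB.
  rewrite -(levy_stationary hX s0 t0 (mopp _ mB)); congr (P _).
  by apply/seteqP; split=> w /=; rewrite oppE.
Qed.

Variables nu mu : R.
Hypothesis nu_gt0 : 0 < nu.
Hypothesis cramer : (\int[P]_w (expR (nu * X 1 w))%:E = 1)%E.
Hypothesis tilt_mean : has_mean P (fun w => X 1 w * expR (nu * X 1 w)) mu.
Hypothesis not_neg_sub : ~ subordinator P (fun t w => - X t w).

Let mX1 : measurable_fun setT (X 1).
Proof. exact: (levy_measurable hX). Qed.

Let has_mean_exp_moment (a : R) (Y : T -> R) : measurable_fun setT Y ->
  (\int[P]_w (expR (a * Y w))%:E = 1)%E -> has_mean P (fun w => expR (a * Y w)) 1.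
Proof.
move=> mY; apply: has_mean_ge0_integral => //.
exact: measurable_tilt.
Qed.

Lemma expR_eq_tangent (y : R) : expR y * (y - 1) + 1 = 0 -> y = 0.
Proof.
move=> H; have [//|y0] := eqVneq y 0; exfalso.
have e0 := expR_gt0 y.
have e1 : expR y * expR (- y) = 1 by rewrite -expRD subrr expR0.
have : 1 + - y < expR (- y) by apply: expR_gt1Dx; rewrite oppr_eq0.
by nra.
Qed.

Lemma expR_tangent_ge0 (y : R) : 0 <= expR y * (y - 1) + 1.
Proof.
have e0 := expR_gt0 y.
have e1 : expR y * expR (- y) = 1 by rewrite -expRD subrr expR0.
have := expR_ge1Dx (- y); nra.
Qed.

(** By convexity of the exponential, [mu <= 0] forces [X 1 = 0] almost surely.  All
exponential moments at time [1] are then [1], hence also those at dyadic times;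
at the two exponents [nu] and [- nu] this forces [X = 0] at these times, and
everywhere by right-continuity.  But the null process is the negative of a
subordinator. *)
Lemma tilted_mean_gt0 : 0 < mu.
Proof.
rewrite ltNge; apply/negP => mu0; apply: not_neg_sub; split.
  exact: levy_process_opp.
have tilt1 := has_mean_exp_moment mX1 cramer.
have X1_0 : {ae P, forall w, X 1 w = 0}.
  have H := has_meanD (has_meanB (has_meanZ nu tilt_mean) tilt1) (has_mean_cst P 1).
  have := has_mean0_ae H _ _; case.
  - move=> w; have := expR_tangent_ge0 (nu * X 1 w).
    by congr (_ <= _); ring.
  - by rewrite subrK pmulr_rle0.
  move=> N [mN PN HN]; exists N; split=> // w /= Hw; apply: HN => /= E; apply: Hw.
  have : nu * X 1 w = 0 by apply: expR_eq_tangent; rewrite -[RHS]E; ring.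
  by move=> /eqP; rewrite mulf_eq0 gt_eqF//= => /eqP.
have opp1 : (\int[P]_w (expR (- nu * X 1 w))%:E = 1)%E.
  have [_ <-] := has_mean_cst P 1.
  apply: ae_eq_integral => //.
  - apply/measurable_EFinP; exact: measurable_tilt.
  - have [N [mN PN HN]] := X1_0; exists N; split=> // w /= Hw; apply: HN => /= E.
    by apply: Hw => _; rewrite E mulr0 expR0.
have grid0ae m k : P.-negligible [set w | grid X m k w != 0].
  have mg := walk_measurable (grid_walk hX m) k.
  have hp := has_mean_exp_moment mg (grid_exp_moment hX m k cramer).
  have hn := has_mean_exp_moment mg (grid_exp_moment hX m k opp1).
  have H := has_meanB (has_meanD hp hn) (has_mean_cst P 2).
  (* Strict convexity: the mean of [expR x + expR (- x) - 2], a positive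
     multiple of a square, vanishes. *)
  have sumE (x : R) : expR x + expR (- x) - 2 =
      expR (- x) * (expR x - 1) ^+ 2.
    have e1 : expR x * expR (- x) = 1 by rewrite -expRD subrr expR0.
    have -> : expR (- x) * (expR x - 1) ^+ 2 =
      (expR x * expR (- x)) * expR x - 2 * (expR x * expR (- x)) + expR (- x) by ring.
    by rewrite e1; ring.
  have sumE' w : expR (nu * grid X m k w) + expR (- nu * grid X m k w) - 2 =
    expR (- (nu * grid X m k w)) * (expR (nu * grid X m k w) - 1) ^+ 2.
    by rewrite mulNr sumE.
  have := has_mean0_ae H _ _; case.
  - by move=> w; rewrite sumE' mulr_ge0 ?expR_ge0// sqr_ge0.
  - by lra.
  move=> N [mN PN HN]; exists N; split=> // w /= /eqP Hw; apply: HN => /= E.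
  apply: Hw; move: E; rewrite sumE' => /eqP.
  rewrite mulf_eq0 gt_eqF ?expR_gt0//= sqrf_eq0 subr_eq0 -expR0 => /eqP/expR_inj/eqP.
  by rewrite mulf_eq0 gt_eqF//= => /eqP.
have [N [mN PN HN]] : P.-negligible (\bigcup_m \bigcup_k [set w | grid X m k w != 0]).
  by apply: negligible_bigcup => m; apply: negligible_bigcup => k.
exists N; split=> // w /= Hw; apply: HN; apply: contrapT => nw.
have g0 m k : X (k%:R / 2 ^+ m) w = 0.
  apply/eqP; apply: contrapT => /negP h; apply: nw.
  by exists m => //; exists k.
have X0 t : 0 <= t -> X t w = 0.
  move=> t0; have [cr _] := levy_cadlag hX w.
  have [crN _] := levy_cadlag levy_process_opp w.
  apply/eqP; rewrite eq_le; apply/andP; split; rewrite leNgt; apply/negP => Xt.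
    have [m [k [_]]] := right_continuous_dyadic t0 (ltr_pwDr ltr01 (lexx t)) (cr t t0) Xt.
    by rewrite g0 ltxx.
  rewrite -oppr_gt0 in Xt.
  have [m [k [_]]] := right_continuous_dyadic t0 (ltr_pwDr ltr01 (lexx t)) (crN t t0) Xt.
  by rewrite g0 oppr0 ltxx.
by apply: Hw => s t s0 st; rewrite !X0// (le_trans s0).
Qed.

End PositiveDrift.

(** * Passage and record times along one path *)

Section Paths.
Context d (T : measurableType d) (R : realType) (P : probability T R).
Variable X : R -> T -> R.
Hypothesis hX : levy_process P X.
Variable w : T.

Lemma passage_time_tau u : passage X u w -> passage_time X u w = (tau X u w)%:E.
Proof.
move=> pu; rewrite /tau fineK// ge0_fin_numE//.
by apply: le_ereal_inf_tmp => _ [t [t0 _] <-]; rewrite lee_fin.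
Qed.

Lemma tau_ge u (c : R) : passage X u w ->
  (forall t, 0 <= t -> u < X t w -> c <= t) -> c <= tau X u w.
Proof.
move=> pu H; rewrite -lee_fin -passage_time_tau//.
by apply: le_ereal_inf_tmp => _ [t [t0 uX] <-]; rewrite lee_fin H.
Qed.

Lemma tau_le u t : 0 <= t -> u < X t w -> tau X u w <= t.
Proof.
move=> t0 uX; rewrite -lee_fin -passage_time_tau; last by apply/passageP; exists t.
by apply: ereal_inf_lbound; exists t.
Qed.

Lemma tau_ge0 u : passage X u w -> 0 <= tau X u w.
Proof. by move=> pu; apply: tau_ge. Qed.

Lemma before_tau_le u r : 0 <= r -> r < tau X u w -> X r w <= u.
Proof.
move=> r0; apply: contraTT; rewrite -ltNge -leNgt => uX.
exact: tau_le.
Qed.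

Lemma near_tau u e : passage X u w -> 0 < e ->
  exists2 t, tau X u w <= t < tau X u w + e & u < X t w.
Proof.
move=> pu e0; have : (passage_time X u w < (tau X u w + e)%:E)%E.
  by rewrite passage_time_tau// lte_fin ltrDl.
move=> /ereal_inf_lt[_ [t [t0 uX] <-]]; rewrite lte_fin => te.
by exists t => //; rewrite te andbT; exact: tau_le.
Qed.

Lemma X_tau_ge u : passage X u w -> u <= X_tau X u w.
Proof.
move=> pu; rewrite /X_tau leNgt; apply/negP => Xu.
have /cvgr_lt/(_ u Xu) [e /= e0 He] := (levy_cadlag hX w).1 _ (tau_ge0 pu).
have [t /andP[tt te] uX] := near_tau pu e0.
move: tt; rewrite le_eqVlt => /orP[/eqP tt|tt].
  by move: uX; rewrite -tt => /(lt_trans Xu); rewrite ltxx.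
have := He t; rewrite /= distrC ger0_norm ?subr_ge0 ?(ltW tt)// ltrBlDl te.
by move=> /(_ isT tt) /(lt_trans uX); rewrite ltxx.
Qed.

Lemma tau_gt0 u : 0 < u -> passage X u w -> 0 < tau X u w.
Proof.
move=> u0 pu; rewrite lt_neqAle tau_ge0// andbT; apply/negP => /eqP H.
have := X_tau_ge pu; rewrite /X_tau -H (levy_start hX).
by rewrite leNgt u0.
Qed.

Definition record_times (t : R) : set R :=
  [set s : R | 0 <= s <= t /\ X s w = running_sup X s w].

Lemma record_time0 t : 0 <= t -> record_times t 0.
Proof.
move=> t0; split; first by rewrite lexx.
rewrite /running_sup (_ : [set _ | _ in _] = [set X 0 w]) ?sup1//.
apply/seteqP; split=> [_ [s /= + <-]|_ ->].
  by rewrite in_itv/= -eq_le => /eqP <-.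
by exists 0 => //=; rewrite in_itv/= lexx.
Qed.

Lemma last_max_time_ge t s : record_times t s -> s <= last_max_time X t w.
Proof.
move=> rs; apply: ub_le_sup => //; exists t => r [/andP[_ rt] _] //.
Qed.

Lemma last_max_time_ge0 t : 0 <= t -> 0 <= last_max_time X t w.
Proof. by move=> t0; apply: last_max_time_ge; exact: record_time0. Qed.

Lemma last_max_time_le t : 0 <= t -> last_max_time X t w <= t.
Proof.
move=> t0; apply: ge_sup; first by exists 0; exact: record_time0.
by move=> s [/andP[_ st] _].
Qed.

Lemma last_max_time_homo s t : 0 <= s -> s <= t ->
  last_max_time X s w <= last_max_time X t w.
Proof.
move=> s0 st; apply: ge_sup; first by exists 0; exact: record_time0.
move=> r [/andP[r0 rs] H]; apply: last_max_time_ge; split=> //.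
by rewrite r0 (le_trans rs).
Qed.

Lemma is_cvg_G u : 0 < u -> passage X u w ->
  cvg (last_max_time X t w @[t --> (tau X u w)^'-]).
Proof.
move=> u0 pu; have t0 := tau_gt0 u0 pu.
apply: nondecreasing_at_left_is_cvgr.
- near=> x; have x0 : 0 < x by near: x; exact: nbhs_left_gt.
  move=> s t; rewrite !in_itv/= => /andP[xs _] /andP[xt _] st.
  by apply: last_max_time_homo => //; rewrite ltW// (lt_trans x0).
- near=> x; have x0 : 0 < x by near: x; exact: nbhs_left_gt.
  exists (tau X u w) => z [t /=]; rewrite in_itv/= => /andP[xt tt] <-.
  apply: le_trans (ltW tt); apply: last_max_time_le.
  by rewrite ltW// (lt_trans x0).
Unshelve. all: by end_near. Qed.

Lemma G_tau_left_le u : 0 < u -> passage X u w -> G_tau_left X u w <= tau X u w.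
Proof.
move=> u0 pu; have t0 := tau_gt0 u0 pu.
apply: limr_le; first exact: is_cvg_G.
near=> t; have tpos : 0 < t by near: t; exact: nbhs_left_gt.
apply: le_trans (last_max_time_le (ltW tpos)) _.
by near: t; exact: nbhs_left_le.
Unshelve. all: by end_near. Qed.

Lemma G_tau_left_ge u c s : 0 < u -> passage X u w -> 0 <= s -> s < tau X u w ->
  (c <= last_max_time X s w) -> c <= G_tau_left X u w.
Proof.
move=> u0 pu s0 stau cs.
apply: limr_ge; first exact: is_cvg_G.
near=> t; apply: le_trans cs _; apply: last_max_time_homo => //.
by near: t; exact: nbhs_left_ge.
Unshelve. all: by end_near. Qed.

Lemma G_tau_left_ge0 u : 0 < u -> passage X u w -> 0 <= G_tau_left X u w.
Proof.
move=> u0 pu; apply: (G_tau_left_ge u0 pu (lexx 0) (tau_gt0 u0 pu)).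
exact: last_max_time_ge0.
Qed.

(** The first passage time above [b] is a record time, even when the path only
reaches [b] there: the path is at most [b] before it and at least [b] at it. *)
Lemma tau_record b t : passage X b w -> tau X b w <= t ->
  record_times t (tau X b w).
Proof.
move=> pb bt; split; first by rewrite tau_ge0.
have bX := X_tau_ge pb; rewrite /X_tau in bX.
apply/eqP; rewrite eq_le; apply/andP; split.
  apply: ub_le_sup; last first.
    by exists (tau X b w) => //=; rewrite in_itv/= tau_ge0// lexx.
  exists (X (tau X b w) w) => z [r /=]; rewrite in_itv/= => /andP[r0 rb] <-.
  move: rb; rewrite le_eqVlt => /orP[/eqP ->//|rb].
  by rewrite (le_trans (before_tau_le r0 rb)).
apply: ge_sup.
  by exists (X 0 w), 0 => //=; rewrite in_itv/= lexx tau_ge0.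
move=> z [r /=]; rewrite in_itv/= => /andP[r0 rb] <-.
move: rb; rewrite le_eqVlt => /orP[/eqP ->//|rb].
by rewrite (le_trans (before_tau_le r0 rb)).
Qed.

(** If the path stays below [b] up to time [n] and exceeds [b] at time [m] before
passing above [u], then the first passage time above [b] is a record time
between [n] and [m], so the last maximum before the passage is at least [n]. *)
Lemma G_tau_left_ge_nat (u b : R) (n m : nat) : 0 < u -> passage X u w ->
  ~ crossed X b n w -> ~ crossed X u m.+1 w -> b < X m%:R w ->
  n%:R <= G_tau_left X u w.
Proof.
move=> u0 pu nb nu bX.
have pb : passage X b w by apply/passageP; exists m%:R.
have um : m%:R < tau X u w.
  apply: (@lt_le_trans _ _ m.+1%:R); first by rewrite ltr_nat.
  apply: tau_ge => // t t0 uX; rewrite leNgt; apply/negP => tm; apply: nu.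
  by exists t => //; rewrite t0 ltW.
have nbt : n%:R <= tau X b w.
  apply: tau_ge => // t t0 uX; rewrite leNgt; apply/negP => tm; apply: nb.
  by exists t => //; rewrite t0 ltW.
apply: (G_tau_left_ge u0 pu _ um) => //.
apply: (le_trans nbt); apply: last_max_time_ge; apply: tau_record => //.
exact: tau_le.
Qed.

Lemma tau_gt_nat u n : passage X u w -> n%:R < tau X u w -> ~ crossed X u n w.
Proof.
move=> pu nt [r /andP[r0 rn] uX].
by have := tau_le r0 uX; rewrite leNgt (le_lt_trans rn).
Qed.

End Paths.

(** * Integrals of functions that need not be measurable *)

Section IntegralTools.
Context d (T : measurableType d) (R : realType) (P : probability T R).
Implicit Types (D : set T) (Z : T -> R).

(** The integral of a nonnegative function is a supremum over the simple functions
below it, so it is monotone without any measurability. *)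
Lemma ge0_le_integral_nonmeasurable D (f g : T -> \bar R) :
  (forall w, D w -> 0 <= f w)%E -> (forall w, D w -> f w <= g w)%E ->
  (\int[P]_(w in D) f w <= \int[P]_(w in D) g w)%E.
Proof.
move=> f0 fg; rewrite !ge0_integralE//; last first.
  by move=> w Dw; apply: le_trans (fg w Dw); exact: f0.
apply: le_ereal_sup => _ [h /= hf <-]; exists h => //= w.
apply: le_trans (hf w) _; rewrite !patchE; case: ifP => // /[!inE]; exact: fg.
Qed.

Lemma geometric_partial_sum_le (k x : R) n : 0 <= k -> 0 <= x -> x < 1 ->
  \sum_(0 <= j < n) k * x ^+ j <= k / (1 - x).
Proof.
move=> k0 x0 x1; have x1' : 0 < 1 - x by rewrite subr_gt0.
rewrite ler_pdivlMr//.
suff -> : (\sum_(0 <= j < n) k * x ^+ j) * (1 - x) = k * (1 - x ^+ n).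
  by rewrite ler_piMr// gerBl exprn_ge0.
elim: n => [|n IHn]; first by rewrite big_nil mul0r expr0 subrr mulr0.
by rewrite big_nat_recr//= mulrDl IHn exprS; ring.
Qed.

(** [Z] is at most [s] plus the number of [j] such that [Z] exceeds [s + j]. *)
Lemma integral_le_geometric D Z (F : nat -> set T) (s k x : R) :
  measurable D -> (forall j, measurable (F j)) ->
  0 <= s -> 0 <= k -> 0 <= x -> x < 1 ->
  (forall w, D w -> 0 <= Z w) ->
  (forall w j, D w -> s + j%:R < Z w -> F j w) ->
  (forall j, (P (F j) <= (k * x ^+ j)%:E)%E) ->
  (\int[P]_(w in D) (Z w)%:E <= (s * fine (P D) + k / (1 - x))%:E)%E.
Proof.
move=> mD mF s0 k0 x0 x1 Z0 ZF PF.
pose h w : \bar R := (s%:E + \sum_(j <oo) (\1_(F j) w)%:E)%E.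
have mind j A : measurable_fun A (fun w => (\1_(F j) w)%:E : \bar R).
  apply: measurable_funTS; apply/measurable_EFinP; exact: measurable_indic.
apply: (@le_trans _ _ (\int[P]_(w in D) h w)%E).
  apply: ge0_le_integral_nonmeasurable => [w Dw|w Dw]; first by rewrite lee_fin Z0.
  have [Zs|Zs] := leP (Z w) s.
    rewrite -[leLHS]adde0; apply: leeD; rewrite ?lee_fin//.
    by apply: nneseries_ge0 => j _ _; rewrite lee_fin.
  pose N := Num.truncn (Z w - s).
  have N1 : N%:R <= Z w - s by rewrite truncn_le// subr_ge0 ltW.
  have N2 : Z w - s < N.+1%:R by exact: truncnS_gt.
  have HF j : (j < N)%N -> F j w.
    move=> jN; apply: ZF => //; rewrite -ltrBrDl; apply: lt_le_trans N1.
    by rewrite ltr_nat.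
  have -> : (Z w)%:E = (s%:E + (Z w - s)%:E)%E by rewrite -EFinD addrC subrK.
  apply: leeD => //.
  apply: (@le_trans _ _ (\sum_(0 <= j < N.+1) (\1_(F j) w)%:E)%E); last first.
    by apply: nneseries_lim_ge => j _ _; rewrite lee_fin.
  rewrite sumEFin lee_fin big_nat_recr//=.
  have -> : \sum_(0 <= j < N) \1_(F j) w = N%:R :> R.
    rewrite (eq_big_nat _ _ (F2 := fun=> 1)); last first.
      by move=> j /andP[_ jN]; rewrite indicE mem_set//; exact: HF.
    by rewrite big_const_nat subn0 iter_addr_0.
  have [E|E] := eqVneq (Z w - s) N%:R; first by rewrite E lerDl.
  rewrite indicE mem_set ?natr1 ?ltW//.
  by apply: ZF => //; rewrite -ltrBrDl lt_neqAle eq_sym E.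
rewrite /h ge0_integralD//; last 2 first.
- by move=> w _; apply: nneseries_ge0 => j _ _; rewrite lee_fin.
- apply: ge0_emeasurable_sum => // j w _ _; by rewrite lee_fin.
rewrite integral_cst// integral_nneseries//.
rewrite EFinD; apply: leeD.
  by rewrite EFinM fineK ?fin_num_measure.
apply: lime_le.
  by apply: is_cvg_nneseries => j _ _; apply: integral_ge0 => w _; rewrite lee_fin.
apply: nearW => n; apply: (@le_trans _ _ (\sum_(0 <= j < n) (k * x ^+ j)%:E)%E).
  apply: lee_sum => j _; rewrite integral_indic//.
  apply: le_trans (PF j); apply: le_measure; rewrite ?inE//.
  exact: measurableI.
by rewrite sumEFin lee_fin geometric_partial_sum_le.
Qed.

Lemma integral_ge_off D B Z (s eta : R) :
  measurable D -> measurable B -> 0 <= s ->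
  (forall w, D w -> 0 <= Z w) -> (forall w, D w -> ~ B w -> s <= Z w) ->
  (P B <= (eta * fine (P D))%:E)%E ->
  ((s * ((1 - eta) * fine (P D)))%:E <= \int[P]_(w in D) (Z w)%:E)%E.
Proof.
move=> mD mB s0 Z0 Zs PB.
apply: (@le_trans _ _ (\int[P]_(w in D) (s * \1_(D `\` B) w)%:E)%E); last first.
  apply: ge0_le_integral_nonmeasurable => w Dw.
    by rewrite lee_fin mulr_ge0.
  rewrite lee_fin indicE; have [/[!inE] -[_ nB]|_] := boolP (w \in D `\` B).
    by rewrite mulr1 Zs.
  by rewrite mulr0 Z0.
have mDB : measurable (D `\` B) by exact: measurableD.
under eq_integral do rewrite EFinM.
rewrite ge0_integralZl//; last first.
  by apply: measurable_funTS; apply/measurable_EFinP; exact: measurable_indic.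
rewrite integral_indic// EFinM; apply: lee_wpmul2l; first by rewrite lee_fin.
rewrite setIidl; last exact: subDsetl.
suff : (((1 - eta) * fine (P D))%:E <= P (D `\` B))%E by [].
have : (P D <= P (D `\` B) + P B)%E.
  have H := measureU2 P mDB mB; apply: le_trans H.
  apply: le_measure; rewrite ?inE//; first exact: measurableU.
  by move=> w Dw; have [Bw|Bw] := pselect (B w); [right|left].
have fin A : measurable A -> exists a, P A = a%:E.
  by move=> mA; exists (fine (P A)); rewrite fineK// fin_num_measure.
move: PB; have [a ->] := fin _ mD; have [b ->] := fin _ mB.
have [c ->] := fin _ mDB; rewrite -EFinD !lee_fin/=; lra.
Qed.

Lemma cvge_of_near_bounds (e : R -> \bar R) (l : R) :
  (forall eps, 0 < eps -> \forall u \near +oo,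
     ((l - eps)%:E <= e u)%E /\ (e u <= (l + eps)%:E)%E) ->
  e u @[u --> +oo] --> l%:E.
Proof.
move=> H; apply: cvg_EFin.
  near=> u; have [] : ((l - 1)%:E <= e u)%E /\ (e u <= (l + 1)%:E)%E.
    by near: u; exact: H.
  by case: (e u).
apply/cvgrPdist_le => eps eps0; near=> u.
have [] : ((l - eps)%:E <= e u)%E /\ (e u <= (l + eps)%:E)%E.
  by near: u; exact: H.
rewrite /=; case: (e u) => [x| |]//; rewrite !lee_fin /= => h1 h2.
by rewrite ler_norml; apply/andP; split; lra.
Unshelve. all: by end_near. Qed.

End IntegralTools.

(** * Events of vanishing conditional probability *)

Section ConditionedPassage.
Context d (T : measurableType d) (R : realType) (P : probability T R).
Variable X : R -> T -> R.
Hypothesis hX : levy_process P X.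
Variables nu mu : R.
Hypothesis nu_gt0 : 0 < nu.
Hypothesis cramer : (\int[P]_w (expR (nu * X 1 w))%:E = 1)%E.
Hypothesis tilt_mean : has_mean P (fun w => X 1 w * expR (nu * X 1 w)) mu.
Hypothesis mu_gt0 : 0 < mu.

Let walk : random_walk P (fun n w => X n%:R w).
Proof.
have := grid_walk hX 0; congr random_walk.
by apply/funext => n; apply/funext => w; rewrite grid0.
Qed.

Let mX1 : measurable_fun setT (X 1) := levy_measurable hX ler01.

Let tilt1 : has_mean P (fun w => expR (nu * X 1 w)) 1.
Proof. exact: (has_mean_tilt walk cramer 1). Qed.

Definition passage_proba (u : R) : R := fine (P (passage X u)).

Lemma passage_probaE u : P (passage X u) = (passage_proba u)%:E.
Proof. by rewrite fineK// fin_num_measure//; exact: (measurable_passage hX). Qed.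

(** The passage probability of the process dominates that of its skeleton at
integer times. *)
Lemma passage_proba_lower_bound : exists2 c : R, 0 < c &
  forall u, 0 <= u -> c * expR (- (nu * u)) <= passage_proba u.
Proof.
have [c c0 Hc] := passage_exponential_lower_bound walk nu_gt0 mu_gt0 tilt1 tilt_mean.
exists c => // u u0; have [N HN] := Hc u u0.
rewrite -lee_fin -passage_probaE; apply: le_trans HN _.
apply: le_measure; rewrite ?inE.
- exact: (measurable_passed walk).
- exact: (measurable_passage hX).
by move=> w [k _ uX]; apply/passageP; exists k%:R.
Qed.

(** A path below [a * (n + 1)] at time [n] moves more slowly than the tilted drift,
so by Chernoff's bound a passage after [n] is exponentially unlikely in [n],
relatively to [expR (- (nu * u))]. *)
Lemma late_passage_rate (a : R) : a < mu -> exists C x : R,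
  [/\ 0 <= C, 0 <= x < 1 & forall u b n, b <= a * n.+1%:R ->
   (P (([set w | (X n%:R w <= b)%R] `\` crossed X u n) `&` passage X u) <=
    (expR (- (nu * u)) * (C * x ^+ n))%:E)%E].
Proof.
move=> amu.
have [theta [rho [/andP[th0 _] hrho rate]]] :=
  chernoff_rate mX1 nu_gt0 tilt1 tilt_mean amu.
have rho0 : 0 <= rho.
  by apply: (has_mean_le (has_mean_cst P 0) hrho) => w; exact: expR_ge0.
exists (expR (theta * a)), (expR (theta * a) * rho); split.
- exact: expR_ge0.
- by rewrite rate mulr_ge0// expR_ge0.
move=> u b n bn; apply: le_trans (late_passage hX nu_gt0 cramer u b n) _.
rewrite EFinM; apply: lee_wpmul2l; first by rewrite lee_fin expR_ge0.
apply: le_trans (lower_deviation walk b n (ltW th0) hrho) _.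
rewrite lee_fin exprMn mulrA ler_wpM2r ?exprn_ge0//.
rewrite -expRM_natl -expRD ler_expR.
have := ler_wpM2l (ltW th0) bn; rewrite -natr1; lra.
Qed.

(** A path that has passed [b >= a * n - C] by time [n] moves faster than the tilted
drift, so its relative cost tends to [0] by the law of large numbers from
above. *)
Lemma early_passage_rate (a C eps : R) : mu < a -> 0 < eps ->
  exists N, forall n, (N <= n)%N -> forall b u, b <= u -> a * n%:R - C <= b ->
   (P (crossed X b n `&` passage X u) <= (expR (- (nu * u)) * eps)%:E)%E.
Proof.
move=> mua eps0; have eps2 : 0 < eps / 2 by rewrite divr_gt0.
have [N HN] := upper_deviation walk nu_gt0 cramer tilt_mean
  (C + ln 2 / nu) mu_gt0 mua eps2.
exists N => n Nn b u bu ab.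
apply: le_trans (early_passage hX nu_gt0 cramer n bu) _.
rewrite EFinM; apply: lee_wpmul2l; first by rewrite lee_fin expR_ge0.
have -> : eps = 2 * (eps / 2) by field.
rewrite EFinM; apply: lee_wpmul2l => //.
apply: le_trans (HN n Nn); apply: ge0_subset_integral => //.
- exact: (measurable_walk_ge walk).
- exact: (measurable_walk_ge walk).
- exact: (measurable_expR_walk walk).
move=> w /=; apply: le_trans; lra.
Qed.

(** The conditional probability of [A u] tends to [0].  The events concern the last
maximum before the passage and may fail to be measurable, hence the measurable
cover [B]. *)
Definition cond_negligible (A : R -> set T) : Prop :=
  forall eta : R, 0 < eta -> \forall u \near +oo, exists B : set T,
  [/\ measurable B, A u `&` passage X u `<=` B &
      (P B <= (eta * passage_proba u)%:E)%E].

Lemma cond_negligibleS (A B : R -> set T) :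
  (forall u, 0 < u -> A u `&` passage X u `<=` B u) ->
  cond_negligible B -> cond_negligible A.
Proof.
move=> AB nB eta eta0; near=> u.
have [C [mC BC PC]] : exists C, [/\ measurable C, B u `&` passage X u `<=` C &
    (P C <= (eta * passage_proba u)%:E)%E] by near: u; exact: nB.
have u0 : 0 < u by near: u; exact: nbhs_pinfty_gt.
by exists C; split=> // w [Aw pw]; apply: BC; split=> //; apply: AB.
Unshelve. all: by end_near. Qed.

Lemma cond_negligibleU (A B : R -> set T) : cond_negligible A ->
  cond_negligible B -> cond_negligible (fun u => A u `|` B u).
Proof.
move=> nA nB eta eta0; have eta2 : 0 < eta / 2 by rewrite divr_gt0.
near=> u.
have [C [mC AC PC]] : exists C, [/\ measurable C, A u `&` passage X u `<=` C &
    (P C <= (eta / 2 * passage_proba u)%:E)%E] by near: u; exact: nA.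
have [D [mD BD PD]] : exists C, [/\ measurable C, B u `&` passage X u `<=` C &
    (P C <= (eta / 2 * passage_proba u)%:E)%E] by near: u; exact: nB.
exists (C `|` D); split; first exact: measurableU.
  by move=> w [[Aw|Bw] pw]; [left; apply: AC|right; apply: BD].
apply: le_trans (measureU2 P mC mD) _.
have -> : eta * passage_proba u =
  eta / 2 * passage_proba u + eta / 2 * passage_proba u by field.
by rewrite EFinD; apply: leeD.
Unshelve. all: by end_near. Qed.

(** The passage probability is at least a multiple of [expR (- (nu * u))], so it is
enough to compare with the latter. *)
Lemma cond_negligible_exp (A : R -> set T) :
  (forall eta, 0 < eta -> \forall u \near +oo, exists B : set T,
    [/\ measurable B, A u `&` passage X u `<=` B &
        (P B <= (expR (- (nu * u)) * eta)%:E)%E]) ->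
  cond_negligible A.
Proof.
move=> H eta eta0; have [c c0 Hc] := passage_proba_lower_bound.
near=> u.
have [B [mB AB PB]] : exists B, [/\ measurable B, A u `&` passage X u `<=` B &
  (P B <= (expR (- (nu * u)) * (eta * c))%:E)%E].
  by near: u; apply: H; rewrite mulr_gt0.
have u0 : 0 <= u by near: u; exact: nbhs_pinfty_ge.
exists B; split=> //; apply: le_trans PB _; rewrite lee_fin.
have := ler_wpM2l (ltW eta0) (Hc u u0); lra.
Unshelve. all: by end_near. Qed.

Lemma near_truncn_ge (alpha : R) (N : nat) : 0 < alpha ->
  \forall u \near +oo, (N <= Num.truncn (alpha * u))%N.
Proof.
move=> a0; near=> u.
have H : N%:R / alpha <= u.
  by near: u; apply: nbhs_pinfty_ge; exact: num_real.
have u0 : 0 <= u by near: u; exact: nbhs_pinfty_ge.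
rewrite truncn_ge_nat ?mulr_ge0// ?(ltW a0)//.
by rewrite mulrC -ler_pdivrMr.
Unshelve. all: by end_near. Qed.

Lemma passage_time_late_negligible (alpha : R) : mu^-1 < alpha ->
  cond_negligible (fun u => [set w | alpha * u < tau X u w]).
Proof.
move=> mua; have a0 : 0 < alpha by apply: lt_trans mua; rewrite invr_gt0.
have amu : alpha^-1 < mu by rewrite -(invrK mu) ltf_pV2 ?posrE// invr_gt0.
have [C [x [C0 /andP[x0 x1] Hx]]] := late_passage_rate amu.
apply: cond_negligible_exp => eta eta0.
have x1' : `|x| < 1 by rewrite ger0_norm.
have [N HN] : exists N, forall n, (N <= n)%N -> C * x ^+ n <= eta.
  have : C * x ^+ n @[n --> \oo] --> C * 0 by apply: cvgMr; exact: cvg_expr.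
  rewrite mulr0 => /cvgr_lt/(_ eta eta0)[N _ HN].
  by exists N => n Nn; apply: ltW; exact: HN.
near=> u.
have u0 : 0 <= u by near: u; exact: nbhs_pinfty_ge.
have Nn : (N <= Num.truncn (alpha * u))%N by near: u; exact: near_truncn_ge.
set n := Num.truncn (alpha * u) in Nn.
have au0 : 0 <= alpha * u by rewrite mulr_ge0// ltW.
have nle : n%:R <= alpha * u by rewrite truncn_le.
have nlt : alpha * u < n.+1%:R by exact: truncnS_gt.
exists (([set w | X n%:R w <= u] `\` crossed X u n) `&` passage X u); split.
- apply: measurableI; last exact: (measurable_passage hX).
  apply: measurableD; first exact: (measurable_walk_le walk).
  exact: (measurable_crossed hX).
- move=> w [/= tw pw]; have nt := le_lt_trans nle tw.
  split=> //; split; first exact: before_tau_le.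
  exact: tau_gt_nat.
apply: le_trans (Hx u u n _) _.
  by rewrite mulrC ler_pdivlMr// mulrC ltW.
by rewrite lee_fin ler_wpM2l ?expR_ge0// HN.
Unshelve. all: by end_near. Qed.

(** Take [alpha < alpha2 < mu^-1] and a level [b] that the tilted drift reaches
between the times [alpha * u] and [alpha2 * u].  Outside of three unlikely
events the path is below [b] until [alpha * u], is above [b] at time
[alpha2 * u], and has not passed above [u] by then; it thus has a record time
after [alpha * u]. *)
Lemma last_max_early_negligible (alpha : R) : 0 < alpha -> alpha < mu^-1 ->
  cond_negligible (fun u => [set w | G_tau_left X u w < alpha * u]).
Proof.
move=> a0 amu.
pose alpha2 := (alpha + mu^-1) / 2.
have mui0 : 0 < mu^-1 by rewrite invr_gt0.
have aa2 : alpha < alpha2 by rewrite /alpha2; lra.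
have a2mu : alpha2 < mu^-1 by rewrite /alpha2; lra.
have a20 : 0 < alpha2 by exact: lt_trans aa2.
pose beta := mu * ((alpha + alpha2) / 2).
have mua2 : mu * alpha2 < 1 by rewrite mulrC -ltr_pdivlMr// div1r.
have mid1 : alpha < (alpha + alpha2) / 2 by lra.
have mid2 : (alpha + alpha2) / 2 < alpha2 by lra.
have b1 : mu * alpha < beta by rewrite ltr_pM2l.
have b2 : beta < mu * alpha2 by rewrite ltr_pM2l.
have beta0 : 0 < beta by apply: lt_trans b1; rewrite mulr_gt0.
have r1 : mu < beta / alpha by rewrite ltr_pdivlMr.
have r2 : beta / alpha2 < mu by rewrite ltr_pdivrMr.
have r3 : mu < alpha2^-1 by rewrite -(invrK mu) ltf_pV2 ?posrE// invr_gt0.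
have [C [x [C0 /andP[x0 x1] Hx]]] := late_passage_rate r2.
apply: cond_negligible_exp => eta eta0.
have x1' : `|x| < 1 by rewrite ger0_norm.
have eta3 : 0 < eta / 3 by rewrite divr_gt0.
have [N HN] : exists N, forall n, (N <= n)%N -> C * x ^+ n <= eta / 3.
  have : C * x ^+ n @[n --> \oo] --> C * 0 by apply: cvgMr; exact: cvg_expr.
  rewrite mulr0 => /cvgr_lt/(_ _ eta3)[N _ HN].
  by exists N => n Nn; apply: ltW; exact: HN.
have [N1 HN1] := early_passage_rate (beta / alpha) r1 eta3.
have [N2 HN2] := early_passage_rate alpha2^-1 r3 eta3.
near=> u.
have u0 : 0 < u by near: u; exact: nbhs_pinfty_gt.
have Nn1 : (N1 <= Num.truncn (alpha * u))%N by near: u; exact: near_truncn_ge.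
have Nn2 : (N2 <= Num.truncn (alpha2 * u))%N by near: u; exact: near_truncn_ge.
have Nn : (N <= Num.truncn (alpha2 * u))%N by near: u; exact: near_truncn_ge.
set n2 := Num.truncn (alpha2 * u) in Nn2 Nn.
pose n1 := (Num.truncn (alpha * u)).+1.
have {}Nn1 : (N1 <= n1)%N by exact: leqW.
have {}Nn2 : (N2 <= n2.+1)%N by exact: leqW.
have au0 : 0 <= alpha * u by rewrite mulr_ge0// ltW.
have au20 : 0 <= alpha2 * u by rewrite mulr_ge0// ltW.
have n1lt : alpha * u < n1%:R by exact: truncnS_gt.
have n1le : n1%:R <= alpha * u + 1 by rewrite -natr1 lerD2r truncn_le.
have n2le : n2%:R <= alpha2 * u by rewrite truncn_le.
have n2lt : alpha2 * u < n2.+1%:R by exact: truncnS_gt.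
pose b := beta * u.
have bu : b <= u by rewrite ler_piMl ?(ltW u0)// ltW// (lt_trans b2).
pose B1 := crossed X b n1 `&` passage X u.
pose B2 := crossed X u n2.+1 `&` passage X u.
pose B3 := ([set w | X n2%:R w <= b] `\` crossed X u n2) `&` passage X u.
have mp : measurable (passage X u) := measurable_passage hX u.
have mB1 : measurable B1 by apply: measurableI => //; exact: (measurable_crossed hX).
have mB2 : measurable B2 by apply: measurableI => //; exact: (measurable_crossed hX).
have mB3 : measurable B3.
  apply: measurableI => //; apply: measurableD; first exact: (measurable_walk_le walk).
  exact: (measurable_crossed hX).
exists (B1 `|` B2 `|` B3); split.
- by apply: measurableU => //; exact: measurableU.
- move=> w [/= Gw pw]; apply: contrapT => nB.
  have nc1 : ~ crossed X b n1 w by move=> c1; apply: nB; left; left.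
  have nc2 : ~ crossed X u n2.+1 w by move=> c2; apply: nB; left; right.
  have bX : b < X n2%:R w.
    rewrite ltNge; apply/negP => Xb; apply: nB; right; split=> //; split=> //.
    move=> [r /andP[r0 rn] uX]; apply: nc2; exists r => //.
    by rewrite r0 (le_trans rn)// ler_nat.
  have := G_tau_left_ge_nat hX u0 pw nc1 nc2 bX.
  by rewrite leNgt (lt_trans Gw).
have PB1 : (P B1 <= (expR (- (nu * u)) * (eta / 3))%:E)%E.
  apply: HN1 => //; rewrite lerBlDr /b.
  have := ler_wpM2l (ltW (divr_gt0 beta0 a0)) n1le.
  by rewrite mulrDr mulr1 mulrA divfK ?gt_eqF.
have PB2 : (P B2 <= (expR (- (nu * u)) * (eta / 3))%:E)%E.
  apply: HN2 => //; rewrite lerBlDr -natr1 mulrDr mulr1 lerD2r.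
  by rewrite mulrC ler_pdivrMr// mulrC.
have PB3 : (P B3 <= (expR (- (nu * u)) * (eta / 3))%:E)%E.
  apply: le_trans (Hx u b n2 _) _; last first.
    by rewrite lee_fin ler_wpM2l ?expR_ge0// HN.
  have := ler_wpM2l (ltW (divr_gt0 beta0 a20)) (ltW n2lt).
  by rewrite mulrA divfK ?gt_eqF.
apply: le_trans (measureU2 P (measurableU _ _ mB1 mB2) mB3) _.
apply: (@le_trans _ _ (P B1 + P B2 + P B3)%E).
  by apply: leeD => //; exact: measureU2.
have -> : expR (- (nu * u)) * eta = expR (- (nu * u)) * (eta / 3) +
  expR (- (nu * u)) * (eta / 3) + expR (- (nu * u)) * (eta / 3) by field.
by rewrite 2!EFinD; apply: leeD => //; apply: leeD.
Unshelve. all: by end_near. Qed.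

(** An overshoot larger than [eps * u] is a passage above [(1 + eps) * u], and this
is exponentially less likely than a passage above [u]. *)
Lemma overshoot_negligible (eps : R) : 0 < eps ->
  cond_negligible (fun u => [set w | (1 + eps) * u < X_tau X u w]).
Proof.
move=> eps0; apply: cond_negligible_exp => eta eta0.
near=> u.
have u0 : 0 < u by near: u; exact: nbhs_pinfty_gt.
have ubig : - ln eta / (nu * eps) <= u.
  by near: u; apply: nbhs_pinfty_ge; exact: num_real.
exists (passage X ((1 + eps) * u)); split; first exact: (measurable_passage hX).
  move=> w [/= Xw pw]; apply/passageP; exists (tau X u w) => //.
  exact: tau_ge0.
apply: le_trans (passage_le hX nu_gt0 cramer _) _; rewrite lee_fin.
rewrite -[X in _ <= _ * X](lnK eta0) -expRD ler_expR.
rewrite ler_pdivrMr ?mulr_gt0// in ubig; lra.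
Unshelve. all: by end_near. Qed.

Lemma cond_proba_cvg0 (A : R -> set T) : cond_negligible A ->
  cond_proba P X u (A u) @[u --> +oo] --> (0 : R).
Proof.
move=> nA; have [c c0 Hc] := passage_proba_lower_bound.
apply/cvgrPdist_le => eta eta0; near=> u.
have [B [mB AB PB]] : exists B, [/\ measurable B, A u `&` passage X u `<=` B &
    (P B <= (eta * passage_proba u)%:E)%E] by near: u; exact: nA.
have u0 : 0 <= u by near: u; exact: nbhs_pinfty_ge.
have p0 : 0 < passage_proba u.
  by apply: lt_le_trans (Hc u u0); rewrite mulr_gt0// expR_gt0.
have ge0 : (0 <= (P^*)%mu (A u `&` passage X u))%E by exact: mu_ext_ge0.
have le : ((P^*)%mu (A u `&` passage X u) <= (eta * passage_proba u)%:E)%E.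
  by apply: le_trans (le_mu_ext P AB) _; rewrite measurable_mu_extE.
rewrite sub0r normrN ger0_norm; last first.
  by rewrite divr_ge0 ?fine_ge0// ltW.
rewrite /cond_proba -/(passage_proba u) ler_pdivrMr//.
by rewrite -lee_fin fineK// ge0_fin_numE// (le_lt_trans le)// ltry.
Unshelve. all: by end_near. Qed.

End ConditionedPassage.

(** * Convergence in conditional probability and of conditional means *)

Section ConditionedExpectation.
Context d (T : measurableType d) (R : realType) (P : probability T R).
Variable X : R -> T -> R.
Hypothesis hX : levy_process P X.
Variables nu mu : R.
Hypothesis nu_gt0 : 0 < nu.
Hypothesis cramer : (\int[P]_w (expR (nu * X 1 w))%:E = 1)%E.
Hypothesis tilt_mean : has_mean P (fun w => X 1 w * expR (nu * X 1 w)) mu.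
Hypothesis mu_gt0 : 0 < mu.

Lemma last_max_deviation_negligible (eps : R) : 0 < eps ->
  cond_negligible P X
    (fun u => [set w | eps < mu^-1 - G_tau_left X u w / u]).
Proof.
move=> eps0; have mui0 : 0 < mu^-1 by rewrite invr_gt0.
pose alpha := Num.max (mu^-1 - eps) (mu^-1 / 2).
have a0 : 0 < alpha by rewrite lt_max divr_gt0 ?orbT.
have amu : alpha < mu^-1.
  by rewrite gt_max gtrBl eps0/= ltr_pdivrMr// ltr_pMr// ltr1n.
apply: cond_negligibleS (last_max_early_negligible hX nu_gt0 cramer tilt_mean
  mu_gt0 a0 amu) => u u0 w [/= H _].
rewrite -ltr_pdivrMr//; apply: (@lt_le_trans _ _ (mu^-1 - eps)).
  lra.
by rewrite le_max lexx.
Qed.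

Lemma passage_time_deviation_negligible (eps : R) : 0 < eps ->
  cond_negligible P X (fun u => [set w | eps < tau X u w / u - mu^-1]).
Proof.
move=> eps0; have H : mu^-1 < mu^-1 + eps by rewrite ltrDl.
apply: cond_negligibleS (passage_time_late_negligible hX nu_gt0 cramer tilt_mean
  mu_gt0 H) => u u0 w [/= Hw _].
by rewrite -ltr_pdivlMr//; lra.
Qed.

Lemma X_tau_cvg_in_proba :
  cvg_in_cond_proba P X (fun u w => X_tau X u w / u) 1.
Proof.
move=> e e0; apply: (cond_proba_cvg0 hX nu_gt0 cramer tilt_mean mu_gt0).
apply: cond_negligibleS (overshoot_negligible hX nu_gt0 cramer tilt_mean
  mu_gt0 e0) => u u0 w [/= Hw pw].
have H : 1 <= X_tau X u w / u by rewrite ler_pdivlMr// mul1r; exact: (X_tau_ge hX).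
rewrite -ltr_pdivlMr// addrC -ltrBrDr; apply: lt_le_trans Hw _.
by rewrite ger0_norm// subr_ge0.
Qed.

Lemma cvg_in_proba_between (Z : R -> T -> R) :
  (forall u w, 0 < u -> passage X u w ->
     G_tau_left X u w <= Z u w <= tau X u w) ->
  cvg_in_cond_proba P X (fun u w => Z u w / u) mu^-1.
Proof.
move=> HZ e e0; apply: (cond_proba_cvg0 hX nu_gt0 cramer tilt_mean mu_gt0).
apply: cond_negligibleS (cond_negligibleU (last_max_deviation_negligible e0)
  (passage_time_deviation_negligible e0)) => u u0 w [/= Hw pw].
have /andP[GZ Zt] := HZ u w u0 pw; have ui0 : 0 < u^-1 by rewrite invr_gt0.
have := ler_wpM2r (ltW ui0) GZ; have := ler_wpM2r (ltW ui0) Zt.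
move: Hw; rewrite ltr_normr => /orP[] Hw h1 h2; [right|left] => /=; lra.
Qed.

(** Even if [Z] is not measurable, its integral is at least that of the simple
function equal to [s * u] off a measurable cover of the exceptional event. *)
Lemma cond_expectation_ge (Z : R -> T -> R) (s eps : R) : 0 <= s -> 0 < eps ->
  (forall u w, 0 < u -> passage X u w -> 0 <= Z u w) ->
  cond_negligible P X (fun u => [set w | Z u w < s * u]) ->
  \forall u \near +oo,
    ((s - eps)%:E <= cond_expectation P X u (Z u) * (u^-1)%:E)%E.
Proof.
move=> s0 eps0 Z0 nZ.
have [c c0 Hc] :=
  passage_proba_lower_bound hX nu_gt0 cramer tilt_mean mu_gt0.
pose eta := eps / (s + 1).
have s1 : 0 < s + 1 by rewrite ltr_wpDl.
have eta0 : 0 < eta by rewrite divr_gt0.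
near=> u; have u0 : 0 < u by near: u; exact: nbhs_pinfty_gt.
have p0 : 0 < passage_proba P X u.
  by apply: lt_le_trans (Hc u (ltW u0)); rewrite mulr_gt0// expR_gt0.
have [B [mB ZB PB]] : exists B,
    [/\ measurable B, [set w | Z u w < s * u] `&` passage X u `<=` B &
        (P B <= (eta * passage_proba P X u)%:E)%E] by near: u; exact: nZ.
have H : ((s * u * ((1 - eta) * passage_proba P X u))%:E <=
    \int[P]_(w in passage X u) (Z u w)%:E)%E.
  apply: integral_ge_off PB => //.
  - exact: (measurable_passage hX).
  - by rewrite mulr_ge0// ltW.
  - by move=> w pw; exact: Z0.
  - by move=> w pw nB; rewrite leNgt; apply/negP => Zw; apply: nB; apply: ZB.
rewrite /cond_expectation -/(passage_proba P X u) -muleA -EFinM.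
have k0 : 0 < (passage_proba P X u)^-1 * u^-1 by rewrite mulr_gt0 ?invr_gt0.
apply: (@le_trans _ _ ((s * u * ((1 - eta) * passage_proba P X u))%:E *
  ((passage_proba P X u)^-1 * u^-1)%:E)%E); last first.
  by apply: lee_wpmul2r => //; rewrite lee_fin ltW.
rewrite -EFinM lee_fin.
have -> : s * u * ((1 - eta) * passage_proba P X u) *
    ((passage_proba P X u)^-1 / u) = s - s * eta.
  by field; rewrite !gt_eqF.
rewrite lerD2l lerN2 /eta mulrA ler_pdivrMr// mulrDr mulr1 mulrC.
by rewrite lerDl ltW.
Unshelve. all: by end_near. Qed.

Lemma cond_expectation_le (Z : R -> T -> R) (s C : R) :
  (\forall u \near +oo, (\int[P]_(w in passage X u) (Z u w)%:E <=
      ((s * u + C) * passage_proba P X u)%:E)%E) ->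
  forall eps, 0 < eps -> \forall u \near +oo,
    (cond_expectation P X u (Z u) * (u^-1)%:E <= (s + eps)%:E)%E.
Proof.
move=> HZ eps eps0.
have [c c0 Hc] :=
  passage_proba_lower_bound hX nu_gt0 cramer tilt_mean mu_gt0.
near=> u; have u0 : 0 < u by near: u; exact: nbhs_pinfty_gt.
have p0 : 0 < passage_proba P X u.
  by apply: lt_le_trans (Hc u (ltW u0)); rewrite mulr_gt0// expR_gt0.
have Cu : C / eps <= u by near: u; apply: nbhs_pinfty_ge; exact: num_real.
have H : (\int[P]_(w in passage X u) (Z u w)%:E <=
      ((s * u + C) * passage_proba P X u)%:E)%E by near: u.
rewrite /cond_expectation -/(passage_proba P X u) -muleA -EFinM.
have k0 : 0 < (passage_proba P X u)^-1 * u^-1 by rewrite mulr_gt0 ?invr_gt0.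
apply: (@le_trans _ _ (((s * u + C) * passage_proba P X u)%:E *
  ((passage_proba P X u)^-1 * u^-1)%:E)%E).
  by apply: lee_wpmul2r => //; rewrite lee_fin ltW.
rewrite -EFinM lee_fin.
have -> : (s * u + C) * passage_proba P X u *
    ((passage_proba P X u)^-1 / u) = s + C / u.
  by field; rewrite !gt_eqF.
by rewrite lerD2l ler_pdivrMr// mulrC -ler_pdivrMr.
Unshelve. all: by end_near. Qed.

(** [X_tau] exceeds [u + j] only if the level [u + j] is passed, and this has a
conditional probability at most a constant times [expR (- (nu * j))]: the
conditional mean of the overshoot is bounded. *)
Lemma integral_X_tau_le : exists C, \forall u \near +oo,
  (\int[P]_(w in passage X u) (X_tau X u w)%:E <=
   ((1 * u + C) * passage_proba P X u)%:E)%E.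
Proof.
have [c c0 Hc] :=
  passage_proba_lower_bound hX nu_gt0 cramer tilt_mean mu_gt0.
pose x := expR (- nu).
have x1 : x < 1 by rewrite -expR0 ltr_expR oppr_lt0.
have x1' : 0 < 1 - x by rewrite subr_gt0.
exists (c^-1 / (1 - x)); near=> u.
have u0 : 0 < u by near: u; exact: nbhs_pinfty_gt.
have mp := measurable_passage hX.
have H := @integral_le_geometric _ _ _ P (passage X u) (X_tau X u)
  (fun j => passage X (u + j%:R)) u (expR (- (nu * u))) x
  (mp u) (fun j => mp _) (ltW u0) (expR_ge0 _) (expR_ge0 _) x1 _ _ _.
apply: le_trans (H _ _ _) _.
- move=> w pw; apply: le_trans (X_tau_ge hX pw); exact: ltW.
- move=> w j pw uX; apply/passageP; exists (tau X u w) => //; exact: tau_ge0.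
- move=> j; apply: le_trans (passage_le hX nu_gt0 cramer _) _.
  rewrite lee_fin -expRM_natl -expRD ler_expR; lra.
rewrite lee_fin -/(passage_proba P X u) mul1r mulrDl lerD2l.
rewrite [leRHS]mulrAC ler_pM2r ?invr_gt0// -ler_pdivrMl ?invr_gt0// invrK.
exact: Hc (ltW u0).
Unshelve. all: by end_near. Qed.

(** With [n] just above [alpha * u], the conditional probability that [tau]
exceeds [n + j] is at most geometric in [j]. *)
Lemma integral_tau_le (alpha : R) : mu^-1 < alpha ->
  exists C, \forall u \near +oo,
  (\int[P]_(w in passage X u) (tau X u w)%:E <=
   ((alpha * u + C) * passage_proba P X u)%:E)%E.
Proof.
move=> mua; have a0 : 0 < alpha by apply: lt_trans mua; rewrite invr_gt0.
have amu : alpha^-1 < mu by rewrite -(invrK mu) ltf_pV2 ?posrE// invr_gt0.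
have [C [x [C0 /andP[x0 x1] Hx]]] :=
  late_passage_rate hX nu_gt0 cramer tilt_mean amu.
have [c c0 Hc] :=
  passage_proba_lower_bound hX nu_gt0 cramer tilt_mean mu_gt0.
have x1' : 0 < 1 - x by rewrite subr_gt0.
exists (1 + C / c / (1 - x)); near=> u.
have u0 : 0 < u by near: u; exact: nbhs_pinfty_gt.
have p0 : 0 < passage_proba P X u.
  by apply: lt_le_trans (Hc u (ltW u0)); rewrite mulr_gt0// expR_gt0.
have au0 : 0 <= alpha * u by rewrite mulr_ge0// ltW.
pose n := (Num.truncn (alpha * u)).+1.
have nlt : alpha * u < n%:R by exact: truncnS_gt.
have nle : n%:R <= alpha * u + 1 by rewrite -natr1 lerD2r truncn_le.
pose F j := ([set w | X (n + j)%:R w <= u] `\` crossed X u (n + j)) `&` passage X u.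
have mF j : measurable (F j).
  apply: measurableI; last exact: (measurable_passage hX).
  apply: measurableD; last exact: (measurable_crossed hX).
  have := measurable_walk_le (grid_walk hX 0) u (n + j).
  by congr measurable; apply/seteqP; split=> w /=; rewrite grid0.
have k0 : 0 <= expR (- (nu * u)) * C by rewrite mulr_ge0// expR_ge0.
have H := @integral_le_geometric _ _ _ P (passage X u) (tau X u) F n%:R
  (expR (- (nu * u)) * C) x (measurable_passage hX u) mF (ler0n _ _) k0 x0 x1 _ _ _.
apply: le_trans (H _ _ _) _.
- by move=> w pw; exact: tau_ge0.
- move=> w j pw; rewrite -natrD => nt; split=> //; split.
    exact: before_tau_le.
  exact: tau_gt_nat.
- move=> j; apply: le_trans (Hx u u (n + j)%N _) _.
    rewrite mulrC ler_pdivlMr// mulrC (le_trans (ltW nlt))// ler_nat.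
    by rewrite -addnS leq_addr.
  rewrite lee_fin -mulrA ler_wpM2l ?expR_ge0// ler_wpM2l// exprD.
  by rewrite ler_piMl ?exprn_ge0// exprn_ile1// ltW.
rewrite lee_fin -/(passage_proba P X u) addrA mulrDl; apply: lerD.
  by rewrite ler_wpM2r// ltW.
rewrite [leRHS]mulrAC ler_pM2r ?invr_gt0// mulrC -mulrA ler_wpM2l//.
by rewrite -ler_pdivrMl ?invr_gt0// invrK Hc// ltW.
Unshelve. all: by end_near. Qed.

Lemma X_tau_expectation_cvg :
  (cond_expectation P X u (X_tau X u) * (u^-1)%:E)%E @[u --> +oo] --> 1%E.
Proof.
apply: cvge_of_near_bounds => eps eps0.
have [C HC] := integral_X_tau_le.
apply: filterI; last exact: cond_expectation_le HC _ eps0.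
apply: cond_expectation_ge => //.
  by move=> u w u0 pw; apply: le_trans (X_tau_ge hX pw); exact: ltW.
move=> eta eta0; near=> u; exists set0; split=> //.
  by move=> w [/= + pw]; rewrite mul1r ltNge (X_tau_ge hX pw).
by rewrite measure0 lee_fin mulr_ge0 ?(ltW eta0)// /passage_proba fine_ge0.
Unshelve. all: by end_near. Qed.

Lemma expectation_cvg_between (Z : R -> T -> R) :
  (forall u w, 0 < u -> passage X u w ->
     G_tau_left X u w <= Z u w <= tau X u w) ->
  (cond_expectation P X u (Z u) * (u^-1)%:E)%E @[u --> +oo] --> (mu^-1)%:E.
Proof.
move=> HZ; have mui0 : 0 < mu^-1 by rewrite invr_gt0.
have Z0 u w : 0 < u -> passage X u w -> 0 <= Z u w.
  move=> u0 pw; have /andP[GZ _] := HZ u w u0 pw.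
  by apply: le_trans GZ; exact: (G_tau_left_ge0 hX).
apply: cvge_of_near_bounds => eps eps0; have eps2 : 0 < eps / 2 by rewrite divr_gt0.
apply: filterI; last first.
  have mua : mu^-1 < mu^-1 + eps / 2 by rewrite ltrDl.
  have [C HC] := integral_tau_le mua.
  have -> : mu^-1 + eps = mu^-1 + eps / 2 + eps / 2 by field; rewrite gt_eqF.
  apply: cond_expectation_le eps2; near=> u.
  have u0 : 0 < u by near: u; exact: nbhs_pinfty_gt.
  have H : (\int[P]_(w in passage X u) (tau X u w)%:E <=
    (((mu^-1 + eps / 2) * u + C) * passage_proba P X u)%:E)%E by near: u; exact: HC.
  apply: le_trans H; apply: ge0_le_integral_nonmeasurable => w pw.
    by rewrite lee_fin Z0.
  by rewrite lee_fin; have /andP[] := HZ u w u0 pw.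
pose alpha := Num.max (mu^-1 - eps / 2) (mu^-1 / 2).
have a0 : 0 < alpha by rewrite lt_max divr_gt0 ?orbT.
have amu : alpha < mu^-1.
  by rewrite gt_max gtrBl eps2/= ltr_pdivrMr// ltr_pMr// ltr1n.
have := @cond_expectation_ge Z alpha (eps / 2) (ltW a0) eps2 Z0 _.
case.
  apply: cond_negligibleS (last_max_early_negligible hX nu_gt0 cramer tilt_mean
    mu_gt0 a0 amu) => u u0 w [/= Hw pw].
  by have /andP[GZ _] := HZ u w u0 pw; exact: le_lt_trans Hw.
move=> M [Mr HM]; exists M; split=> // u /HM; apply: le_trans; rewrite lee_fin.
have : mu^-1 - eps / 2 <= alpha by rewrite le_max lexx.
lra.
Unshelve. all: by end_near. Qed.

End ConditionedExpectation.

(** The negative part of [x * expR (nu * x)] is at most [nu^-1], so it is the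
positive part that finiteness from above controls. *)
Lemma tilted_mean_integrable d (T : measurableType d) (R : realType)
    (P : probability T R) (xi : T -> R) (nu : R) :
  measurable_fun setT xi -> 0 < nu ->
  (\int[P]_w (xi w * expR (nu * xi w))%:E < +oo)%E ->
  has_mean P (fun w => xi w * expR (nu * xi w))
    (fine (\int[P]_w (xi w * expR (nu * xi w))%:E)%E).
Proof.
move=> mxi nu0 lty; apply: has_mean_exists.
pose f w := xi w * expR (nu * xi w).
have mf : measurable_fun setT f.
  by apply: measurable_funM => //; exact: measurable_tilt.
have mE : measurable_fun setT (EFin \o f) by exact/measurable_EFinP.
have neg : (\int[P]_w (EFin \o f)^\- w <= (nu^-1)%:E)%E.
  have [_ <-] := has_mean_cst P nu^-1.
  apply: ge0_le_integral => //.
  - exact: measurable_funeneg.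
  - move=> w _; rewrite funenegE /= -EFin_max lee_fin ge_max invr_ge0 (ltW nu0) andbT.
    by have := tilted_value_ge0 nu0 (xi w); rewrite /f; lra.
move: lty; rewrite integralE => lty.
apply/integrableP; split=> //.
have -> : (\int[P]_w `|(EFin \o f) w|)%E =
    (\int[P]_w (EFin \o f)^\+ w + \int[P]_w (EFin \o f)^\- w)%E.
  rewrite -ge0_integralD//; [|exact: measurable_funepos|exact: measurable_funeneg].
  by apply: eq_integral => w _; rewrite -[LHS]/((abse \o (EFin \o f)) w) fune_abse.
have n0 : (0 <= \int[P]_w (EFin \o f)^\- w)%E by exact: integral_ge0.
have p0 : (0 <= \int[P]_w (EFin \o f)^\+ w)%E by exact: integral_ge0.
move: lty neg n0 p0; rewrite -/f.
case: (\int[P]_w (EFin \o f)^\- w)%E => [a| |]//.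
by case: (\int[P]_w (EFin \o f)^\+ w)%E => [b| |]//= _ _ _ _; rewrite ltry.
Qed.

Theorem theorem3p1 (d : measure_display) (T : measurableType d) (R : realType)
  (P : probability T R) (X : R -> T -> R) (gamma sigma : R)
  (Pi : {measure set (measurableTypeR R) -> \bar R}) (nu0 : R)
  (hX : levy_process P X)
  (hPi : levy_triplet P X gamma sigma Pi)
  (Pi_neq0 : Pi setT <> 0%E)
  (not_neg_sub : ~ subordinator P (fun t w => - X t w))
  (nu0_gt0 : 0 < nu0)
  (cramer : cramer_condition P X nu0)
  (mu_star_lty : (mu_star P X nu0 < +oo)%E) :
  let mu := fine (mu_star P X nu0) in
  [/\ cvg_in_cond_proba P X (fun u w => X_tau X u w / u) 1,
      cvg_in_cond_proba P X (fun u w => G_tau_left X u w / u) mu^-1 &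
      cvg_in_cond_proba P X (fun u w => tau X u w / u) mu^-1] /\
  ((compound_poisson gamma sigma Pi -> ~ lattice_set (measure_support Pi)) ->
   [/\ (cond_expectation P X u (X_tau X u) * (u^-1)%:E)%E @[u --> +oo] --> 1%E,
       (cond_expectation P X u (G_tau_left X u) * (u^-1)%:E)%E @[u --> +oo]
         --> (mu^-1)%:E &
       (cond_expectation P X u (tau X u) * (u^-1)%:E)%E @[u --> +oo]
         --> (mu^-1)%:E]).
Proof.
have tilt1 : (\int[P]_w (expR (nu0 * X 1 w))%:E = 1)%E.
  by move: cramer; rewrite /cramer_condition unlock.
have tilt_mean : has_mean P (fun w => X 1 w * expR (nu0 * X 1 w))
    (fine (mu_star P X nu0)).
  move: mu_star_lty; rewrite /mu_star unlock => lty.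
  by apply: tilted_mean_integrable => //; exact: (levy_measurable hX).
move=> mu.
have mu_gt0 : 0 < mu := tilted_mean_gt0 hX nu0_gt0 tilt1 tilt_mean not_neg_sub.
have betweenG u w : 0 < u -> passage X u w ->
    G_tau_left X u w <= G_tau_left X u w <= tau X u w.
  by move=> u0 pw; rewrite lexx (G_tau_left_le hX).
have betweent u w : 0 < u -> passage X u w ->
    G_tau_left X u w <= tau X u w <= tau X u w.
  by move=> u0 pw; rewrite lexx (G_tau_left_le hX).
split; [split|move=> _; split].
- exact: (X_tau_cvg_in_proba hX nu0_gt0 tilt1 tilt_mean mu_gt0).
- exact: (cvg_in_proba_between hX nu0_gt0 tilt1 tilt_mean mu_gt0 betweenG).
- exact: (cvg_in_proba_between hX nu0_gt0 tilt1 tilt_mean mu_gt0 betweent).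
- exact: (X_tau_expectation_cvg hX nu0_gt0 tilt1 tilt_mean mu_gt0).
- exact: (expectation_cvg_between hX nu0_gt0 tilt1 tilt_mean mu_gt0 betweenG).
- exact: (expectation_cvg_between hX nu0_gt0 tilt1 tilt_mean mu_gt0 betweent).
Qed.
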